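(* Let $\Omega$ be a bounded convex domain in $\mathbf{R}^n$ ($n\ge 1$), let $D:=\Omega\times(0,\infty)$, and let $f$ be a nonnegative function in $\Omega$. Let $u\in C^{2,1}(D)\cap C(\overline{D})$ satisfy $$\partial_t u=\Delta u+f(x)\quad\text{in } D,\qquad u=0\quad\text{on }\partial D,$$ and put $H(t):=\int_\Omega u(x,t)\,dx$. (i) If $f$ is $q$-concave in $\Omega$ for some $q\ge 1$, then $H$ is $\beta$-concave in $(0,\infty)$ with $\beta=q/[(n+2)q+1]$. (ii) If $f$ is a positive constant in $\Omega$, then $H$ is $\beta$-concave in $(0,\infty)$ with $\beta=1/(n+2)$.
   Context: Means: for $a,b>0$, $\lambda\in(0,1)$ and $p\in[-\infty,\infty]$, $M_p(a,b;\lambda)=[(1-\lambda)a^p+\lambda b^p]^{1/p}$ if $p\notin\{-\infty,0,\infty\}$, $M_0(a,b;\lambda)=a^{1-\lambda}b^\lambda$, $M_\infty(a,b;\lambda)=\max\{a,b\}$, $M_{-\infty}(a,b;\lambda)=\min\{a,b\}$. For $a,b\ge0$ the same formulas are used if $p\ge 0$, and $M_p(a,b;\lambda)=0$ if $p<0$ and $ab=0$. $p$-concavity: a nonnegative function $v$ on a convex set $K\subset\mathbf{R}^m$ is $p$-concave if $v((1-\lambda)x+\lambda y)\ge M_p(v(x),v(y);\lambda)$ for all $x,y\in K$, $\lambda\in(0,1)$. $\partial D$ is the boundary of $D$ in $\mathbf{R}^{n+1}$, i.e. $(\partial\Omega\times[0,\infty))\cup(\Omega\times\{0\})$, so the boundary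 condition includes zero initial data. *)

(* Defs.v *)
From HB Require Import structures.
From mathcomp Require Import all_boot all_order all_algebra.
From mathcomp Require Import all_classical all_reals all_analysis.
Set Implicit Arguments.
Unset Strict Implicit.
Unset Printing Implicit Defensive.
Import Order.TTheory GRing.Theory Num.Theory.
Import numFieldNormedType.Exports.
Local Open Scope classical_set_scope.
Local Open Scope ring_scope.

(* Lebesgue measure on R^n is built as the n-fold product of the Lebesgue
   measure on R.  It lives on [n.-tuple], which carries the product
   sigma-algebra, whereas the topology, norm and linear structure of R^n are
   those of ['rV[R]_n]; [row_of_tuple] identifies the two. *)
Section cons_measure.
Context {R : realType} {d : measure_display} {T : measurableType d} {n : nat}.

Definition cons_pair (p : T * n.-tuple T) : n.+1.-tuple T :=
  [tuple of p.1 :: p.2].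

Definition uncons_pair (x : n.+1.-tuple T) : T * n.-tuple T :=
  (thead x, [tuple of behead x]).

Lemma cons_pairK : cancel cons_pair uncons_pair.
Proof.
by case=> a t; rewrite /uncons_pair theadE; congr pair; exact: val_inj.
Qed.

Lemma measurable_cons_pair : measurable_fun setT cons_pair.
Proof. exact: measurable_cons. Qed.

Lemma measurable_uncons_pair : measurable_fun setT uncons_pair.
Proof.
apply/measurable_fun_pairP; split; first exact: measurable_tnth.
exact: measurable_behead.
Qed.

Variables (m1 : {sigma_finite_measure set T -> \bar R})
  (m2 : {sigma_finite_measure set (n.-tuple T) -> \bar R}).

Definition cons_measure : set (n.+1.-tuple T) -> \bar R :=
  pushforward (m1 \x m2)%E cons_pair.

Let cons_measure0 : cons_measure set0 = 0%E.
Proof. by rewrite /cons_measure /pushforward preimage_set0 measure0. Qed.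

Let cons_measure_ge0 A : (0 <= cons_measure A)%E.
Proof. by rewrite /cons_measure /pushforward measure_ge0. Qed.

Let cons_measure_sigma_additive : semi_sigma_additive cons_measure.
Proof.
have mcons A : measurable A -> measurable (cons_pair @^-1` A).
  by move=> mA; rewrite -[X in measurable X]setTI; exact: measurable_cons_pair.
move=> F mF tF mUF; rewrite /cons_measure /pushforward preimage_bigcup.
apply: measure_semi_sigma_additive => [i||]; first exact: mcons.
- apply/trivIsetP => i j _ _ ij; rewrite -preimage_setI.
  by move/trivIsetP : tF => /(_ _ _ _ _ ij) -> //; rewrite preimage_set0.
- by rewrite -preimage_bigcup; exact: mcons.
Qed.

HB.instance Definition _ := isMeasure.Build _ _ _ cons_measure
  cons_measure0 cons_measure_ge0 cons_measure_sigma_additive.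

Let cons_measure_sigma_finite : sigma_finite setT cons_measure.
Proof.
have /sigma_finiteP[F [TF ndF Foo]] := sigma_finiteT m1.
have /sigma_finiteP[G [TG ndG Goo]] := sigma_finiteT m2.
exists (fun k => uncons_pair @^-1` (F k `*` G k)).
  rewrite predeqE => x; split => // _.
  have [i _ Fi] : (\bigcup_i F i) (uncons_pair x).1 by rewrite -TF.
  have [j _ Gj] : (\bigcup_i G i) (uncons_pair x).2 by rewrite -TG.
  exists (maxn i j) => //; split.
  - by move: Fi; exact/subsetPset/ndF/leq_maxl.
  - by move: Gj; exact/subsetPset/ndG/leq_maxr.
move=> k; have [mF Fk] := Foo k; have [mG Gk] := Goo k; split.
  rewrite -[X in measurable X]setTI.
  by apply: measurable_uncons_pair => //; exact: measurableX.
rewrite /cons_measure /pushforward -comp_preimage.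
have -> : uncons_pair \o cons_pair = id.
  by apply/funext => p; exact: cons_pairK.
by rewrite preimage_id product_measure1E// lte_mul_pinfty// ge0_fin_numE.
Qed.

HB.instance Definition _ := Measure_isSigmaFinite.Build _ _ _ cons_measure
  cons_measure_sigma_finite.

End cons_measure.

Fixpoint lebesgue_measure_n (R : realType) (n : nat) :
    {sigma_finite_measure set (n.-tuple (measurableTypeR R)) -> \bar R} :=
  match n with
  | 0 => \d_ [tuple]
  | m.+1 => cons_measure lebesgue_measure (lebesgue_measure_n R m)
  end.

Definition row_of_tuple (R : realType) (n : nat)
    (x : n.-tuple (measurableTypeR R)) : 'rV[R]_n := \row_(i < n) tnth x i.

Definition integral_Rn (R : realType) (n : nat) (A : set 'rV[R]_n)
    (g : 'rV[R]_n -> R) : R :=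
  \int[lebesgue_measure_n R n]_(x in @row_of_tuple R n @^-1` A) g (row_of_tuple x).

Definition bounded_convex_domain (R : realType) (n : nat)
    (Omega : set 'rV[R]_n) : Prop :=
  [/\ open Omega, Omega !=set0, connected Omega, bounded_set Omega &
      convex_set Omega].

Definition boundary (T : topologicalType) (A : set T) : set T :=
  closure A `\` interior A.

(* The convention 0 for p < 0 and ab = 0 is automatic when p = -oo. *)
Definition power_mean (R : realType) (p : \bar R) (a b lam : R) : R :=
  match p with
  | +oo%E => Num.max a b
  | -oo%E => Num.min a b
  | r%:E =>
      if r == 0 then a `^ (1 - lam) * b `^ lam
      else if (r < 0) && (a * b == 0) then 0
      else ((1 - lam) * a `^ r + lam * b `^ r) `^ r^-1
  end.

(* Meaningful for convex [K]. *)
Definition p_concave (R : realType) (E : lmodType R) (p : \bar R) (K : set E)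
    (v : E -> R) : Prop :=
  (forall x, K x -> 0 <= v x) /\
  (forall (x y : E) (lam : R), K x -> K y -> 0 < lam < 1 ->
    power_mean p (v x) (v y) lam <= v ((1 - lam) *: x + lam *: y)).

Section parabolic.
Context {R : realType} {n : nat}.
Implicit Types (D : set ('rV[R]_n * R)) (u : 'rV[R]_n * R -> R).

Definition space_dir (i : 'I_n) : 'rV[R]_n * R := (delta_mx 0 i, 0).

Definition time_dir : 'rV[R]_n * R := (0, 1).

Definition cylinder (Omega : set 'rV[R]_n) : set ('rV[R]_n * R) :=
  Omega `*` `]0, +oo[.

Definition continuously_derivable D u (v : 'rV[R]_n * R) : Prop :=
  (forall z, D z -> derivable u z v) /\ {within D, continuous ('D_v u)}.

Definition C21 D u : Prop :=
  [/\ {within D, continuous u},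
      continuously_derivable D u time_dir,
      (forall i, continuously_derivable D u (space_dir i)) &
      (forall i j, continuously_derivable D ('D_(space_dir i) u) (space_dir j))].

Definition laplacian u (z : 'rV[R]_n * R) : R :=
  \sum_(i < n) 'D_(space_dir i) ('D_(space_dir i) u) z.

End parabolic.

(* Main.v *)
(* Write w = u^(1/(2 + r)), with r = 1/q in case (i) and r = 0 in case (ii). First, w is concave in
   space and time jointly. Dilating the solution about a point z0 of the closed cylinder gives a
   supersolution, so u(l z + (1 - l) z0) >= l^(2 + r) u(z). Hence a positive maximum of
   (1 - l) w(z0) + l w(z1) - w((1 - l) z0 + l z1) is attained only where u(z0) and u(z1) are positive,
   that is, at interior points. There the first and second order conditions, the parabolic equation
   of w, and the inequality u_t >= 0 are contradictory by the q-concavity of f. Second, integrating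
   a jointly 1/s-concave function over one variable gives a 1/(s + 1)-concave function of the others
   (Borell-Brascamp-Lieb); n integrations turn 2 + r into n + 2 + r = 1/beta. *)

Require Import Defs.
From mathcomp Require Import all_boot all_order all_algebra.
From mathcomp Require Import all_classical all_reals all_analysis measurable_realfun.
From mathcomp Require Import ring lra.
Import Order.TTheory GRing.Theory Num.Theory.
Import numFieldNormedType.Exports.
Local Open Scope classical_set_scope.
Local Open Scope ring_scope.
Set Implicit Arguments.
Unset Strict Implicit.
Unset Printing Implicit Defensive.

(** * Derivative tests at a maximum *)

(** The exponent 2 + r collects two scalings: a dilation by [l] multiplies the Laplacian by l^2, and
    the source obeys f(l x + (1 - l) x0) >= l^r f(x). Time is dilated by the same factor as space,
    as joint concavity in (x, t) demands; the time derivative then carries l where l^2 would be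
    expected, and u_t >= 0 gives the difference the right sign.

    Regularity shapes the maximum arguments. No derivative mixing space and time is available, [u]
    is not known to be positive inside, and its root need not be differentiable at zeros of [u].
    Hence the tests run along one coordinate line at a time, on compact time slabs whose final time
    allows only backward steps, and strictness comes from a penalty [e * t] rather than from a
    strong maximum principle.

    Joint concavity also makes the integration elementary: time becomes a parameter, every partial
    integral is again concave after a root, so its superlevel sets are intervals, and the
    Brunn-Minkowski inequality is needed on the line only, against an interval. *)

Section one_variable_tests.
Context {R : realType}.
Implicit Types g : R -> R.

(** At the final time of a slab a maximum can only be compared with earlier times; difference
    quotients with negative step are then nonnegative. *)
Lemma left_max_derive_ge0 g (d : R) : is_derive (0 : R) 1 g d ->
  (\forall s \near 0^'-, g s <= g 0) -> 0 <= d.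
Proof.
move=> [dg <-] gmax.
have /cvg_dnbhs_at_left dg' : h^-1 *: ((g \o shift 0) (h *: 1) - g 0) @[h --> 0^'] --> 'D_1 g 0.
  exact: dg.
apply: (cvgr_to_ge dg'); near=> h.
have h0 : h < 0 by near: h; exact: nbhs_left_lt.
change (0 <= h^-1 * (g (h * 1 + 0) - g 0)).
rewrite addr0 mulr1 mulr_le0 ?invr_le0 ?(ltW h0)// subr_le0.
by near: h.
Unshelve. all: by end_near. Qed.

Lemma local_max_derive_eq0 g (d : R) : is_derive (0 : R) 1 g d ->
  (\forall s \near 0, g s <= g 0) -> d = 0.
Proof.
move=> dg gmax; apply/eqP; rewrite eq_le; apply/andP; split; last first.
  by apply: (left_max_derive_ge0 dg); exact: cvg_at_left_filter gmax.
rewrite -oppr_ge0 -[- d]mulrN1.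
have dg' : is_derive (- 0 : R) 1 g d by rewrite oppr0.
apply: (@left_max_derive_ge0 (g \o -%R)).
have Nx : -%R (x : R) @[x --> 0] --> (0 : R).
  by rewrite -[X in _ --> X]oppr0; exact: opp_continuous.
have gN : \forall s \near (0 : R), g (- s) <= g 0 by exact: Nx gmax.
by rewrite /= oppr0; exact: (@cvg_at_left_filter R R id 0 0 (fun _ => id) _ gN).
Qed.

(** Otherwise the first derivative, zero at the maximum, would be positive just to the right of it,
    and the mean value theorem would produce a larger value. *)
Lemma local_max_derive2_le0 g (dg : R -> R) (d : R) : (\forall s \near (0 : R), is_derive (s : R) 1 g (dg s)) ->
  is_derive (0 : R) 1 dg d -> (\forall s \near 0, g s <= g 0) -> d <= 0.
Proof.
move=> gd dgd gmax; rewrite leNgt; apply/negP => d0.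
have dg0 : dg 0 = 0 by apply: local_max_derive_eq0 gmax; exact: nbhs_singleton gd.
have dgpos : \forall s \near 0^'+, 0 < dg s.
  have [dgd1 dgd2] := dgd.
  have /cvg_dnbhs_at_right : h^-1 *: ((dg \o shift 0) (h *: 1) - dg 0) @[h --> 0^'] --> 'D_1 dg 0.
    exact: dgd1.
  rewrite dgd2 => /cvgr_gt/(_ _ d0); apply: filter_app; near=> h.
  have h0 : 0 < h by near: h; exact: nbhs_right_gt.
  change (0 < h^-1 * (dg (h * 1 + 0) - dg 0) -> 0 < dg h).
  by rewrite addr0 mulr1 dg0 subr0 pmulr_rgt0// invr_gt0.
have : \forall s \near (0 : R), [/\ is_derive (s : R) 1 g (dg s), g s <= g 0 & 0 < s -> 0 < dg s].
  by near=> s; split; [near: s|near: s|near: s; move: dgpos; rewrite /at_right near_withinE].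
move=> /nbhs_ballP[e /= e0 He].
have {}He s : 0 <= s <= e / 2 -> [/\ is_derive (s : R) 1 g (dg s), g s <= g 0 & 0 < s -> 0 < dg s].
  move=> se; apply: He; rewrite /ball/= ltr_norml; lra.
have e20 : 0 < e / 2 by lra.
have [] := @MVT R g dg 0 (e / 2) e20.
- by move=> x; rewrite in_itv /= => xe; have [] := He x; [lra|].
- apply: derivable_within_continuous => x; rewrite in_itv/= => xe.
  by have [[]] := He _ xe.
move=> c; rewrite in_itv /= subr0 => ce E.
have [|_ _ dc] := He c; first lra.
have [|_ ge _] := He (e / 2); first lra.
have := mulr_gt0 (dc _) e20; rewrite -E; lra.
Unshelve. all: by end_near. Qed.

End one_variable_tests.

Lemma is_derive_line {R : realType} {V : normedModType R} (u : V -> R) (z v : V) (a s : R) :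
  derivable u (z + (a * s) *: v) v ->
  is_derive s 1 (fun s => u (z + (a * s) *: v)) (a * 'D_v u (z + (a * s) *: v)).
Proof.
move=> du; rewrite mulrC.
pose l t := u (z + t *: v).
have dl : is_derive (a * s) 1 l ('D_v u (z + (a * s) *: v)).
  have E : (fun h => h^-1 *: ((l \o shift (a * s)) (h *: 1) - l (a * s))) =
      (fun h => h^-1 *: ((u \o shift (z + (a * s) *: v)) (h *: v) - u (z + (a * s) *: v))).
    apply/funext => h; rewrite /l /=; congr (_ *: (u _ - _)).
    by rewrite [_%:A]mulr1 scalerDl addrCA.
  by split; rewrite /derivable /derive E.
apply: (@is_derive1_comp _ l (fun s => a * s)).
have : is_derive s 1 (a *: id) (a *: (1 : R)) by exact: is_deriveZ.
by rewrite [X in is_derive _ _ _ X]mulr1.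
Qed.

(** * Cylinders over convex domains *)

Lemma within_continuous_map {T U W : topologicalType} (A : set T) (B : set U)
    (g : T -> U) (f : U -> W) :
  continuous g -> (forall x, A x -> B (g x)) -> {within B, continuous f} ->
  {within A, continuous (f \o g)}.
Proof.
move=> cg AB /subspace_continuousP cf; apply/subspace_continuousP => x Ax.
move=> S /(cf _ (AB _ Ax)) /=; rewrite !nbhs_filterE /= /nbhs /= => BS.
have := cg x _ BS; rewrite /nbhs /= /within /= => H.
by move: H; apply: filterS => y H Ay; apply: H; exact: AB.
Qed.

Lemma nbhs_setX {T U : topologicalType} (x : T) (y : U) P Q :
  nbhs x P -> nbhs y Q -> nbhs (x, y) (P `*` Q).
Proof. by move=> nP nQ; exists (P, Q). Qed.

Lemma near_line {R : realType} {V : normedModType R} (A : set V) (z v : V) (a : R) :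
  open A -> A z -> \forall s \near (0 : R), A (z + (a * s) *: v).
Proof.
move=> oA Az.
have cl : (z + (a * s) *: v) @[s --> (0 : R)] --> z + (a * 0) *: v.
  apply: cvgD; first exact: cvg_cst.
  apply: cvgZr_tmp; apply: cvgM; [exact: cvg_cst|exact: cvg_id].
apply: cl; rewrite mulr0 scale0r addr0; exact: open_nbhs_nbhs.
Qed.

Lemma convex_set_comb {R : realType} {E : lmodType R} (A : set E) (x y : E) (l : R) :
  convex_set A -> A x -> A y -> 0 <= l <= 1 -> A ((1 - l) *: x + l *: y).
Proof.
move=> cA Ax Ay /andP[l0 l1].
have := cA y x (Itv01 l0 l1); rewrite !inE => /(_ Ay Ax).
by rewrite addrC.
Qed.

Lemma closure_comb {R : realType} {V : normedModType R} (A B : set V) (x y : V) (a b : R) :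
  (forall x' y', A x' -> A y' -> B (a *: x' + b *: y')) ->
  closure A x -> closure A y -> closure B (a *: x + b *: y).
Proof.
move=> AB clx cly S nS.
have cc : (a *: p.1 + b *: p.2) @[p --> (x, y)] --> a *: x + b *: y.
  by apply: cvgD; apply: cvgZl_tmp; [exact: cvg_fst|exact: cvg_snd].
have [[P Q] [/= nP nQ] PQ] := cc _ nS.
have [x' [Ax' Px']] := clx _ nP; have [y' [Ay' Qy']] := cly _ nQ.
by exists (a *: x' + b *: y'); split; [exact: AB|exact: (PQ (x', y'))].
Qed.

Section cylinder_topology.
Context {R : realType} {n : nat} (Omega : set 'rV[R]_n).
Hypothesis hOmega : bounded_convex_domain Omega.

Lemma open_cylinder : open (cylinder Omega).
Proof.
have [oO _ _ _ _] := hOmega.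
rewrite openE => -[x t] [/= Ox t0].
exists (Omega, `]0, +oo[%classic) => //=; split.
  exact: open_nbhs_nbhs.
by apply: open_nbhs_nbhs; split => //; exact: interval_open.
Qed.

Lemma closure_cylinder z : closure (cylinder Omega) z <-> closure Omega z.1 /\ 0 <= z.2.
Proof.
case: z => x0 t0; split=> [cz|[/= cz1 z2] S [[P Q] [/= nP nQ] PQ]].
  split.
    move=> S nS; have [|w [[Ow _] Sw]] := cz (S `*` setT).
      by apply: nbhs_setX => //; exact: filterT.
    by exists w.1; split => //; case: Sw.
  rewrite leNgt; apply/negP => t00.
  have [|w [[_ w2] [_ Sw]]] := cz (setT `*` `]-oo, 0[%classic).
    apply: nbhs_setX; first exact: filterT.
    by apply: open_nbhs_nbhs; split; [exact: interval_open|rewrite /= in_itv].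
  by move: w2 Sw; rewrite /= !in_itv /= andbT => /lt_trans h /h; rewrite ltxx.
have [x [Ox Px]] := cz1 _ nP.
have [e /= e0 Qe] : exists2 e : R, 0 < e & forall t, `|t0 - t| < e -> Q t.
  by move: nQ => /nbhs_ballP[e /= e0 He]; exists e.
(* The time [t0] may be 0, so the approximating point is taken slightly later. *)
exists (x, t0 + e / 2); split.
  by split => //=; rewrite in_itv /= andbT; lra.
apply: PQ; split => //=; apply: Qe; rewrite ltr_norml; lra.
Qed.

Lemma closure_setminus_boundary z : closure (cylinder Omega) z ->
  ~ cylinder Omega z -> boundary (cylinder Omega) z.
Proof. by move=> cz nz; split => //; move=> /interior_subset. Qed.

Lemma compact_closure_Omega : compact (closure Omega).
Proof.
have [_ _ _ [M [Mr bO]] _] := hOmega.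
apply: bounded_closed_compact; last exact: closed_closure.
exists (M + 1); split; first by rewrite num_real.
move=> N MN x clx /=; have : closure [set y : 'rV[R]_n | `|y| <= N] x.
  apply: (closureS _ clx) => y Oy /=.
  apply: bO Oy; apply: lt_trans MN; lra.
rewrite -(closure_id _).1 //.
by apply: closed_comp (@closed_le R N) => y _ /=; exact: norm_continuous.
Qed.

Lemma compact_slab (T : R) : compact (closure Omega `*` `[0, T]).
Proof. by apply: compact_setX; [exact: compact_closure_Omega|exact: segment_compact]. Qed.

Lemma slab_closure (T : R) z : (closure Omega `*` `[0, T]) z -> closure (cylinder Omega) z.
Proof.
by move=> [cz]; rewrite /= in_itv /= => /andP[z0 _]; apply/closure_cylinder.
Qed.

Lemma Omega_comb x y l : Omega x -> Omega y -> 0 <= l <= 1 -> Omega ((1 - l) *: x + l *: y).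
Proof. by have [_ _ _ _ cO] := hOmega; exact: convex_set_comb. Qed.

Lemma cylinder_comb z w l : cylinder Omega z -> cylinder Omega w -> 0 <= l <= 1 ->
  cylinder Omega ((1 - l) *: z + l *: w).
Proof.
move=> [z1 z2] [w1 w2] l01; split => /=; first exact: Omega_comb.
by move: z2 w2; rewrite /= !in_itv/= !andbT => z2 w2; rewrite /GRing.scale /=; nra.
Qed.

Lemma closure_cylinder_comb z w l : closure (cylinder Omega) z ->
  closure (cylinder Omega) w -> 0 <= l <= 1 ->
  closure (cylinder Omega) ((1 - l) *: z + l *: w).
Proof.
by move=> cz cw l01; apply: closure_comb cz cw => x y Ox Oy; exact: cylinder_comb.
Qed.

End cylinder_topology.

(** * Maximum tests along parallel lines through three points *)

Section line_tests.
Context {R : realType} {V : normedModType R}.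
Variables (U : V -> R) (v z0 z1 z2 : V) (c0 c1 c2 a0 a1 a2 : R).

(** The points [z0], [z1], [z2] move parallel to [v] with speeds [a0], [a1], [a2]; each
    differentiation multiplies a weight by its speed. [comparison] gives the third point weight 0,
    [root_concave] uses the weights [1 - l], [l], [-1]. *)
Let g (W : V -> R) (b0 b1 b2 s : R) :=
  b0 * W (z0 + (a0 * s) *: v) + b1 * W (z1 + (a1 * s) *: v) + b2 * W (z2 + (a2 * s) *: v).

Let g0 W b0 b1 b2 : g W b0 b1 b2 0 = b0 * W z0 + b1 * W z1 + b2 * W z2.
Proof. by rewrite /g !mulr0 !scale0r !addr0. Qed.

Let is_derive_g W b0 b1 b2 s :
  derivable W (z0 + (a0 * s) *: v) v -> derivable W (z1 + (a1 * s) *: v) v ->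
  derivable W (z2 + (a2 * s) *: v) v ->
  is_derive s 1 (g W b0 b1 b2) (g ('D_v W) (b0 * a0) (b1 * a1) (b2 * a2) s).
Proof.
move=> d0 d1 d2.
have := is_deriveD (is_deriveD (is_deriveZ b0 (is_derive_line d0))
  (is_deriveZ b1 (is_derive_line d1))) (is_deriveZ b2 (is_derive_line d2)).
by rewrite /g -!mulrA.
Qed.

(** The slope [e] is what a penalty linear in time contributes to the maximised function; it is the
    source of every strict inequality later. *)
Lemma line_test_left (e : R) :
  derivable U z0 v -> derivable U z1 v -> derivable U z2 v ->
  (\forall s \near 0^'-, c0 * U (z0 + (a0 * s) *: v) + c1 * U (z1 + (a1 * s) *: v) +
     c2 * U (z2 + (a2 * s) *: v) <= c0 * U z0 + c1 * U z1 + c2 * U z2 + e * s) ->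
  e <= c0 * a0 * 'D_v U z0 + c1 * a1 * 'D_v U z1 + c2 * a2 * 'D_v U z2.
Proof.
move=> d0 d1 d2 gmax.
have dg : is_derive (0 : R) 1 (g U c0 c1 c2) (g ('D_v U) (c0 * a0) (c1 * a1) (c2 * a2) 0).
  by apply: (@is_derive_g U c0 c1 c2 0); rewrite mulr0 scale0r addr0.
have dge := is_deriveB dg (is_deriveZ e (is_derive_id (0 : R) 1)).
have /= := @left_max_derive_ge0 _ _ _ dge.
rewrite g0 subr_ge0 [e *: 1]mulr1; apply.
apply: filterS gmax => s; rewrite !fctE g0.
by change (c0 * U (z0 + (a0 * s) *: v) + c1 * U (z1 + (a1 * s) *: v) +
  c2 * U (z2 + (a2 * s) *: v) <= c0 * U z0 + c1 * U z1 + c2 * U z2 + e * s ->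
  g U c0 c1 c2 s - e * s <= c0 * U z0 + c1 * U z1 + c2 * U z2 - e * 0);
  rewrite mulr0 subr0 lerBlDr.
Qed.

Lemma line_test : (\forall z \near z0, derivable U z v) -> (\forall z \near z1, derivable U z v) ->
  (\forall z \near z2, derivable U z v) -> derivable ('D_v U) z0 v ->
  derivable ('D_v U) z1 v -> derivable ('D_v U) z2 v ->
  (\forall s \near (0 : R), c0 * U (z0 + (a0 * s) *: v) + c1 * U (z1 + (a1 * s) *: v) +
     c2 * U (z2 + (a2 * s) *: v) <= c0 * U z0 + c1 * U z1 + c2 * U z2) ->
  c0 * a0 * 'D_v U z0 + c1 * a1 * 'D_v U z1 + c2 * a2 * 'D_v U z2 = 0 /\
  c0 * a0 ^+ 2 * 'D_v ('D_v U) z0 + c1 * a1 ^+ 2 * 'D_v ('D_v U) z1 +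
    c2 * a2 ^+ 2 * 'D_v ('D_v U) z2 <= 0.
Proof.
move=> d0 d1 d2 dd0 dd1 dd2 gmax.
have gmax' : \forall s \near (0 : R), g U c0 c1 c2 s <= g U c0 c1 c2 0.
  by apply: filterS gmax => s; rewrite g0.
have nl z a : (\forall z \near z, derivable U z v) ->
    \forall s \near (0 : R), derivable U (z + (a * s) *: v) v.
  rewrite -nbhs_nearE nbhsE => -[A [oA Az] AU].
  by apply: filterS (near_line v a oA Az) => s; exact: AU.
have dg : \forall s \near (0 : R),
    is_derive (s : R) 1 (g U c0 c1 c2) (g ('D_v U) (c0 * a0) (c1 * a1) (c2 * a2) s).
  by apply: filterS3 (nl _ a0 d0) (nl _ a1 d1) (nl _ a2 d2) => s; exact: is_derive_g.
have dg0 := nbhs_singleton dg.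
split; first by rewrite -(local_max_derive_eq0 dg0 gmax') g0.
have ddg : is_derive (0 : R) 1 (g ('D_v U) (c0 * a0) (c1 * a1) (c2 * a2))
    (g ('D_v ('D_v U)) (c0 * a0 * a0) (c1 * a1 * a1) (c2 * a2 * a2) 0).
  by apply: (@is_derive_g ('D_v U) (c0 * a0) (c1 * a1) (c2 * a2) 0); rewrite mulr0 scale0r addr0.
by have := local_max_derive2_le0 dg ddg gmax'; rewrite g0 !expr2 !mulrA.
Qed.

End line_tests.

(** * Powers of functions *)

(** Reduces a directional derivative to one real variable, where the chain rule applies. *)
Lemma is_derive_lineE {R : realType} {V : normedModType R} (g : V -> R) (z v : V) (d : R) :
  is_derive (0 : R) 1 (fun h => g (h *: v + z)) d <-> is_derive z v g d.
Proof.
have E : (fun h => h^-1 *: (((fun h => g (h *: v + z)) \o shift 0) (h *: 1) - g (0 *: v + z))) =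
    (fun h : R => h^-1 *: ((g \o shift z) (h *: v) - g z)).
  by apply/funext => h /=; rewrite addr0 [_%:A]mulr1 scale0r add0r.
by split=> -[]; rewrite /derivable /derive => d1 d2; split; rewrite /derivable /derive -?E// ?E.
Qed.

Lemma is_derive_powR {R : realType} {V : normedModType R} (g : V -> R) (z v : V) (p : R) :
  derivable g z v -> 0 < g z ->
  is_derive z v (fun w => g w `^ p) (p * g z `^ (p - 1) * 'D_v g z).
Proof.
move=> dg gz; apply/is_derive_lineE.
have dl : is_derive (0 : R) 1 (fun h => g (h *: v + z)) ('D_v g z).
  by apply/is_derive_lineE; exact: derivableP.
have dp : is_derive (g (0 *: v + z)) 1 (@powR R ^~ p) (p * g z `^ (p - 1)).
  by rewrite scale0r add0r; exact: is_derive1_powR.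
exact: (@is_derive1_comp R (@powR R ^~ p) (fun h => g (h *: v + z)) 0 _ _ dp dl).
Qed.

(** The formula for the first derivative is itself differentiated, so it has to hold on a
    neighbourhood of [z]; this is why [g] is positive there and not just at [z]. *)
Lemma is_derive2_powR {R : realType} {V : normedModType R} (g : V -> R) (z v : V) (p : R) :
  (\forall w \near z, derivable g w v /\ 0 < g w) -> derivable ('D_v g) z v ->
  is_derive z v ('D_v (fun w => g w `^ p))
   (p * (g z `^ (p - 1) * 'D_v ('D_v g) z + (p - 1) * g z `^ (p - 1 - 1) * ('D_v g z) ^+ 2)).
Proof.
move=> ng ddg.
have [dg gz] := nbhs_singleton ng.
have E : \forall w \near z, (p * (g w `^ (p - 1) * 'D_v g w) = 'D_v (fun w => g w `^ p) w).
  by apply: filterS ng => w [dw gw]; have [_ ->] := is_derive_powR p dw gw; rewrite mulrA.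
apply: near_eq_is_derive E _.
have := is_deriveZ p (is_deriveM (is_derive_powR (p - 1) dg gz) (derivableP ddg)).
suff -> : (p - 1) * g z `^ (p - 1 - 1) * 'D_v g z ^+ 2 =
  'D_v g z *: ((p - 1) * g z `^ (p - 1 - 1) * 'D_v g z) by [].
by rewrite expr2 [_ *: _]mulrC mulrA.
Qed.

(** The absolute value secures continuity on both sides of 0, whatever [powR] is at negative bases,
    and changes nothing for nonnegative functions. *)
Lemma continuous_norm_powR {R : realType} (p : R) : 0 < p ->
  continuous (fun x : R => `|x| `^ p).
Proof.
move=> p0 x; have [->|x0] := eqVneq x 0.
  rewrite /continuous_at normr0 powR0 ?gt_eqF//.
  apply/cvgrPdist_lt => e e0.
  have near0 : \forall y \near (0 : R), `|y| < e `^ p^-1.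
    by apply: (@cvgr0_norm_lt _ _ _ (nbhs (0 : R)) _ id cvg_id); rewrite powR_gt0.
  near=> y.
  rewrite sub0r normrN ger0_norm ?powR_ge0//.
  have -> : e = (e `^ p^-1) `^ p by rewrite -powRrM mulVf ?gt_eqF// powRr1// ltW.
  rewrite gt0_ltr_powR// ?nnegrE ?powR_ge0//.
  by near: y.
apply: (@continuous_comp _ _ _ (@Num.norm _ R) (@powR R ^~ p)); first exact: norm_continuous.
apply/differentiable_continuous/derivable1_diffP.
by apply: derivable_powR; rewrite in_itv /= andbT normr_gt0.
Unshelve. all: by end_near. Qed.

Lemma within_continuous_powR {R : realType} {T : topologicalType} (A : set T) (g : T -> R) (p : R) :
  0 < p -> (forall x, A x -> 0 <= g x) -> {within A, continuous g} ->
  {within A, continuous (fun x => g x `^ p)}.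
Proof.
move=> p0 g0 /subspace_continuousP cg.
have : {within A, continuous (fun x => `|g x| `^ p)}.
  apply/subspace_continuousP => x Ax.
  have cn : `|y| `^ p @[y --> g x] --> `|g x| `^ p by exact: continuous_norm_powR.
  exact: (@cvg_comp _ _ _ g (fun y => `|y| `^ p) _ _ _ (cg x Ax) cn).
by apply: subspace_eq_continuous => x; rewrite inE => Ax; rewrite /from_subspace ger0_norm// g0.
Qed.

(* The three points of [root_concave] at the maximum: [w], [T], [L], [f] are the values there of
   [u^(1/s)], its time derivative, its Laplacian and the source, [G] the common squared gradient. *)
Lemma max_point_contradiction {R : realType} (r l w0 w1 wl e G T0 T1 Tl f0 f1 fl L0 L1 Ll : R) :
  let s := 2 + r in let W := (1 - l) * w0 + l * w1 in
  let a := w0 / W in let b := w1 / W in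
  let kap := (1 - l) * a ^+ 2 + l * b ^+ 2 in
  0 <= r -> 0 < l < 1 -> 0 < w0 -> 0 < w1 -> 0 < wl -> wl < W -> 0 < e -> 0 <= G ->
  0 <= Tl -> 0 <= fl ->
  L0 = T0 - s^-1 * w0 `^ (1 - s) * f0 - (s - 1) * G / w0 ->
  L1 = T1 - s^-1 * w1 `^ (1 - s) * f1 - (s - 1) * G / w1 ->
  Ll = Tl - s^-1 * wl `^ (1 - s) * fl - (s - 1) * G / wl ->
  (1 - l) * a ^+ 2 * L0 + l * b ^+ 2 * L1 <= Ll ->
  e * kap <= (1 - l) * a ^+ 2 * T0 + l * b ^+ 2 * T1 - kap * Tl ->
  (1 - l) * a `^ (1 - r) * f0 + l * b `^ (1 - r) * f1 <= fl -> False.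
Proof.
move=> s W a b kap r0 /andP[l0 l1] w0p w1p wlp mW e0 G0 Tl0 fl0 E0 E1 El lap tim forcing.
have k0 : 0 < 1 - l by rewrite subr_gt0.
have W0 : 0 < W by exact: lt_trans mW.
have a0 : 0 < a by rewrite divr_gt0.
have b0 : 0 < b by rewrite divr_gt0.
have ab1 : (1 - l) * a + l * b = 1.
  by rewrite /a /b !mulrA -mulrDl -/W divff// gt_eqF.
have s1 : 0 <= s - 1 by rewrite /s addrAC addr_ge0// subr_ge0 ler1n.
have sV : 0 <= s^-1 by rewrite invr_ge0 /s addr_ge0.
(* The numbers [a] and [b] have weighted mean 1, so [kap] is 1 plus their variance. *)
have kap1 : 1 <= kap.
  rewrite -subr_ge0; have -> : kap - 1 = (1 - l) * (a - 1) ^+ 2 + l * (b - 1) ^+ 2 +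
      2 * ((1 - l) * a + l * b - 1) by rewrite /kap; ring.
  by rewrite ab1 subrr mulr0 addr0 addr_ge0// mulr_ge0 ?sqr_ge0// ltW.
(* The exponent 2 + (1 - s) = 1 - r is the one in the concavity condition on the source. *)
have scale_pow (c y : R) : 0 < c -> y = c * W -> c ^+ 2 * y `^ (1 - s) = c `^ (1 - r) * W `^ (1 - s).
  move=> c0 ->; rewrite powRM ?(ltW c0) ?(ltW W0)// mulrA -(powR_mulrn 2 (ltW c0)).
  rewrite -powRD ?(gt_eqF c0) ?implybT//; congr (_ `^ _ * _).
  by rewrite /s; ring.
have aW : w0 = a * W by rewrite /a divfK// gt_eqF.
have bW : w1 = b * W by rewrite /b divfK// gt_eqF.
have powle : W `^ (1 - s) <= wl `^ (1 - s).
  rewrite -[1 - s]opprB !powRN lef_pV2 ?posrE ?powR_gt0//.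
  by rewrite ge0_ler_powR// ?nnegrE ltW.
have gradle : G / W <= G / wl.
  by rewrite ler_wpM2l// lef_pV2 ?posrE// ltW.
(* After multiplication by c^2 the gradient term depends linearly on [c], since c^2 / w = c / W; the
   terms of the two points then add up to a single (s - 1) G / W. *)
have mean (c w k T f0' L : R) : 0 < c -> w = c * W ->
    L = T - s^-1 * w `^ (1 - s) * f0' - (s - 1) * G / w ->
    k * c ^+ 2 * L = k * c ^+ 2 * T - s^-1 * (W `^ (1 - s) * (k * c `^ (1 - r) * f0')) -
      (s - 1) * (G / W) * (k * c).
  move=> c0 wE ->.
  have -> : k * c ^+ 2 * (T - s^-1 * w `^ (1 - s) * f0' - (s - 1) * G / w) =
    k * c ^+ 2 * T - s^-1 * ((c ^+ 2 * w `^ (1 - s)) * (k * f0')) -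
    (s - 1) * G * (c ^+ 2 / w) * k by ring.
  rewrite (scale_pow _ _ c0 wE).
  have -> : c ^+ 2 / w = c / W by rewrite wE; field; rewrite !gt_eqF.
  ring.
move: lap; rewrite (mean _ _ _ _ _ _ a0 aW E0) (mean _ _ _ _ _ _ b0 bW E1) El.
set P := W `^ (1 - s) in powle *.
have P0 : 0 <= P by exact: powR_ge0.
have FF : P * ((1 - l) * a `^ (1 - r) * f0 + l * b `^ (1 - r) * f1) <= wl `^ (1 - s) * fl.
  apply: le_trans (ler_wpM2l P0 forcing) _; exact: ler_wpM2r.
have SF := ler_wpM2l sV FF; have SG := ler_wpM2l s1 gradle.
have SE : (s - 1) * (G / W) * ((1 - l) * a) + (s - 1) * (G / W) * (l * b) = (s - 1) * (G / W).
  by rewrite -mulrDr ab1 mulr1.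
have ek : e <= e * kap by rewrite ler_peMr// ltW.
have Tk : Tl <= kap * Tl by rewrite ler_peMl.
rewrite !mulrDr in SF; rewrite -[s^-1 * _ * fl]mulrA -[(s - 1) * G / wl]mulrA.
(* Source and gradient terms drop out with the right sign. What is left is
   [e * kap + kap * Tl <= Tl], impossible because [kap >= 1], [Tl >= 0] and [e > 0]. *)
clear - SF SG SE ek Tk tim e0.
move: SF SG SE ek Tk tim.
move: (s^-1 * (P * ((1 - l) * _ * f0))) => F0; move: (s^-1 * (P * (l * _ * f1))) => F1.
move: (s^-1 * (_ * fl)) => F; move: (_ * ((1 - l) * a)) => g0; move: (_ * (l * b)) => g1.
move: ((s - 1) * (G / W)) ((s - 1) * (G / wl)) => g h.
move: ((1 - l) * a ^+ 2 * T0) (l * b ^+ 2 * T1) (e * kap) (kap * Tl) => X0 X1 Y Z.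
lra.
Qed.

(** * The heat equation *)

Section heat_equation.
Context {R : realType} {n : nat} (Omega : set 'rV[R]_n) (f : 'rV[R]_n -> R)
  (u : 'rV[R]_n * R -> R).
Local Notation D := (cylinder Omega).
Hypotheses (hOmega : bounded_convex_domain Omega)
  (hf : forall x, Omega x -> 0 <= f x)
  (hu : C21 D u)
  (hu_closure : {within closure D, continuous u})
  (heq : forall (x : 'rV[R]_n) (t : R), D (x, t) ->
    'D_time_dir u (x, t) = laplacian u (x, t) + f x)
  (hbd : forall z, boundary D z -> u z = 0).

Let heat z : D z -> laplacian u z = 'D_time_dir u z - f z.1.
Proof. by case: z => x t Dz; rewrite heq // addrK. Qed.

Let u_time z : D z -> derivable u z time_dir.
Proof. by have [_ [du _] _ _] := hu; exact: du. Qed.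

Let u_space i z : D z -> derivable u z (space_dir i).
Proof. by have [_ _ du _] := hu; exact: (du i).1. Qed.

Let u_space2 i z : D z -> derivable ('D_(space_dir i) u) z (space_dir i).
Proof. by have [_ _ _ du] := hu; exact: (du i i).1. Qed.

Let near_D (P : 'rV[R]_n * R -> Prop) z : D z -> (forall w, D w -> P w) -> \forall w \near z, P w.
Proof.
move=> Dz DP; apply: filterS DP _.
by apply: open_nbhs_nbhs; split => //; exact: open_cylinder.
Qed.

Let space_line z i (a : R) : D z -> \forall s \near (0 : R), D (z + (a * s) *: space_dir i).
Proof. by move=> Dz; apply: near_line => //; exact: open_cylinder. Qed.

Let space_slab z i (a T : R) : D z -> z.2 <= T ->
  \forall s \near (0 : R), (closure Omega `*` `[0, T]) (z + (a * s) *: space_dir i).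
Proof.
move=> Dz zT; apply: filterS (space_line i a Dz) => s [Os ts]; split; first exact: subset_closure.
move: ts; rewrite /= !in_itv /= andbT => /ltW ->.
by rewrite /GRing.scale /= mulr0 addr0.
Qed.

Let time_slab z (a T : R) : 0 <= a -> D z -> z.2 <= T ->
  \forall s \near 0^'-, (closure Omega `*` `[0, T]) (z + (a * s) *: time_dir).
Proof.
move=> a0 Dz zT; near=> s.
have s0 : s <= 0 by near: s; exact: nbhs_left_le.
have : D (z + (a * s) *: time_dir).
  near: s; apply: cvg_at_left_filter (@cvg_id _ (nbhs (0 : R))) _ _.
  by apply: near_line => //; exact: open_cylinder.
move=> [Os ts]; split; first exact: subset_closure.
move: ts; rewrite /= !in_itv /= andbT => /ltW ->.
by rewrite /GRing.scale /= mulr1; nra.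
Unshelve. all: by end_near. Qed.

(* Weak maximum principle for [mu u(lam z + c) - kap u(z)]; the three instances used are [u] itself,
   a translation in time, and a dilation about a point. *)
Lemma comparison (mu lam kap : R) (c : 'rV[R]_n * R) :
  (forall z, closure D z -> closure D (lam *: z + c)) ->
  (forall z, D z -> D (lam *: z + c)) ->
  (forall z, closure D z -> mu * u (lam *: z + c) < kap * u z -> D z) ->
  (forall z, D z -> mu * lam ^+ 2 * 'D_time_dir u (lam *: z + c) <=
     mu * lam * 'D_time_dir u (lam *: z + c)) ->
  (forall z, D z -> kap * f z.1 <= mu * lam ^+ 2 * f (lam *: z + c).1) ->
  forall z, closure D z -> kap * u z <= mu * u (lam *: z + c).
Proof.
move=> clD inD posD timeD forceD z clz; rewrite leNgt; apply/negP => neg.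
set T := z.2; pose K : set ('rV[R]_n * R) := closure Omega `*` `[0, T].
have [clz1 z20] := (closure_cylinder Omega z).1 clz.
(* The penalty at [z] is less than half of the gap, so the maximum of [F] is positive and [posD]
   places it inside the cylinder. *)
pose e := (kap * u z - mu * u (lam *: z + c)) / (2 * (T + 1)).
have T0 : 0 <= T by [].
have e0 : 0 < e by rewrite divr_gt0 ?subr_gt0 //; lra.
have Kz : K z by split => //=; rewrite in_itv /= z20 lexx.
pose F w := kap * u w - mu * u (lam *: w + c) - e * w.2.
have cF : {within K, continuous F}.
  have KD p : K p -> closure D p by exact: slab_closure.
  have cu : {within K, continuous u}.
    exact: (within_continuous_map (g := id) (fun x => cvg_id (F := nbhs x)) KD hu_closure).
  have ca : {within K, continuous (u \o (fun p => lam *: p + c))}.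
    apply: within_continuous_map hu_closure.
      by move=> p; apply: cvgD; [apply: cvgZl_tmp; exact: cvg_id|exact: cvg_cst].
    by move=> p /KD; exact: clD.
  have c2 : {within K, continuous (fun p : 'rV[R]_n * R => p.2)}.
    by apply: continuous_subspaceT => p; exact: cvg_snd.
  move/subspace_continuousP in cu; move/subspace_continuousP in ca.
  move/subspace_continuousP in c2.
  apply/subspace_continuousP => p Kp.
  apply: cvgB; [apply: cvgB|]; apply: cvgM; try exact: cvg_cst.
  - exact: cu.
  - exact: ca.
  - exact: c2.
have [w] := compact_EVT_max (ex_intro _ z Kz) (@compact_slab _ _ _ hOmega T) cF.
rewrite inE => Kw Fmax; have {}Fmax p : K p -> F p <= F w by move=> Kp; apply: Fmax; rewrite inE.
have Dw : D w.
  apply: posD; first exact: slab_closure Kw.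
  have Fz : 0 < F z.
    rewrite /F -/T.
    have -> : kap * u z - mu * u (lam *: z + c) = e * (2 * (T + 1)) by rewrite /e divfK //; lra.
    nra.
  have := lt_le_trans Fz (Fmax _ Kz); rewrite /F.
  have : 0 <= w.2 by have [_] := Kw; rewrite /= in_itv /= => /andP[].
  nra.
have wT : w.2 <= T by have [_] := Kw; rewrite /= in_itv /= => /andP[].
have Dw' := inD _ Dw.
pose w' := lam *: w + c.
have lap : kap * laplacian u w <= mu * lam ^+ 2 * laplacian u w'.
  rewrite /laplacian !mulr_sumr; apply: ler_sum => i _.
  have nD p : D p -> \forall q \near p, derivable u q (space_dir i).
    by move=> Dp; refine (@near_D (fun q => derivable u q (space_dir i)) p Dp (@u_space i)).
  have := @line_test R _ u (space_dir i) w w' w' kap (- mu) 0 1 lam 0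
    (nD _ Dw) (nD _ Dw') (nD _ Dw') (u_space2 Dw) (u_space2 Dw') (u_space2 Dw').
  rewrite !mul0r !addr0 expr1n mulr1 !mulNr subr_le0 => h; apply: (h _).2.
  apply: filterS (space_slab i 1 Dw wT) => s Ks.
  have := Fmax _ Ks; rewrite /F.
  have -> : lam *: (w + (1 * s) *: space_dir i) + c = w' + (lam * s) *: space_dir i.
    by rewrite mul1r scalerDr scalerA addrAC.
  have -> : (w + (1 * s) *: space_dir i).2 = w.2 by rewrite /= /GRing.scale /= mulr0 addr0.
  by rewrite lerD2r mul0r addr0 mulNr.
have tim : e <= kap * 'D_time_dir u w - mu * lam * 'D_time_dir u w'.
  have := @line_test_left R _ u time_dir w w' w' kap (- mu) 0 1 lam 0 e.
  rewrite !mul0r !addr0 mulr1 !mulNr; apply.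
  1-3: exact: u_time.
  apply: filterS (time_slab ler01 Dw wT) => s Ks.
  have := Fmax _ Ks; rewrite /F.
  have -> : lam *: (w + (1 * s) *: time_dir) + c = w' + (lam * s) *: time_dir.
    by rewrite mul1r scalerDr scalerA addrAC.
  have -> : (w + (1 * s) *: time_dir).2 = w.2 + s by rewrite /= /GRing.scale /= mulr1 mul1r.
  by rewrite mulrDr opprD addrA lerBlDr [leRHS]addrAC lerD2r mul0r addr0 mulNr.
(* The test in space yields the factor lam^2 and the test in time only lam; [timeD] bridges the two,
   and [forceD] compares the sources. Together they force [e <= 0]. *)
have := timeD _ Dw; have := forceD _ Dw; rewrite -/w'.
move: lap; rewrite !heat // !mulrBr; lra.
Qed.

Let u_out z : closure D z -> ~ D z -> u z = 0.
Proof. by move=> cz nz; apply: hbd; exact: closure_setminus_boundary. Qed.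

(** [comparison] with [kap = 0] and the identity map: a negative value can only occur inside, where
    the source is nonnegative. *)
Lemma solution_ge0 z : closure D z -> 0 <= u z.
Proof.
move=> clz; have id1 w : (1 : R) *: w + 0 = w :> 'rV[R]_n * R by rewrite scale1r addr0.
suff : 0 * u z <= 1 * u (1 *: z + 0) by rewrite id1 mul0r mul1r.
apply: comparison => //.
- by move=> w; rewrite id1.
- by move=> w; rewrite id1.
- move=> w clw; rewrite id1 !mul1r mul0r => uw; apply: contrapT => nDw.
  by move: uw; rewrite u_out// ltxx.
- by move=> w _; rewrite expr1n.
- by move=> w [Ow _]; rewrite id1 mul0r expr1n !mul1r; exact: hf.
Qed.

Let posD z : closure D z -> 0 < u z -> D z.
Proof. by move=> cz uz; apply: contrapT => nDz; move: uz; rewrite u_out// ltxx. Qed.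

(** The source does not depend on time, so the shifted solution solves the same equation, with
    nonnegative initial values. This monotonicity is what yields u_t >= 0. *)
Lemma solution_time_shift h z : 0 <= h -> closure D z -> u z <= u (z + (0, h)).
Proof.
move=> h0 clz; suff : 1 * u z <= 1 * u (1 *: z + (0, h)) by rewrite !mul1r scale1r.
apply: comparison => //.
- move=> w /closure_cylinder[w1 w2]; apply/closure_cylinder; rewrite scale1r /= addr0.
  by split => //; rewrite addr_ge0.
- move=> w [w1 /= w2]; rewrite scale1r; split => /=; first by rewrite addr0.
  by move: w2; rewrite !in_itv /= !andbT => w2; rewrite ltr_wpDr.
- move=> w clw; rewrite scale1r !mul1r => uw; apply: posD => //.
  apply: le_lt_trans uw; apply: solution_ge0.
  move: clw => /closure_cylinder[w1 w2]; apply/closure_cylinder; rewrite /= addr0.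
  by split => //; rewrite addr_ge0.
- by move=> w _; rewrite expr1n.
- by move=> w Dw; rewrite scale1r /= addr0 expr1n !mul1r.
Qed.

Lemma solution_dt_ge0 z : D z -> 0 <= 'D_time_dir u z.
Proof.
move=> Dz; have := @line_test_left R _ u time_dir z z z 1 0 0 1 0 0 0.
rewrite !mul0r !addr0 !mul1r; apply.
1-3: exact: u_time.
apply: filterS2 (nbhs_left_le (0 : R)) (@time_slab z 1 z.2 ler01 Dz (lexx _)) => s s0 Ks.
rewrite !mul1r !mul0r !addr0.
have h0 : 0 <= - s by rewrite oppr_ge0.
have := solution_time_shift h0 (slab_closure Ks).
suff E : z + s *: time_dir + (0, - s) = z by rewrite mul1r E.
by rewrite /time_dir; case: z {Dz Ks} => x t; congr (_, _) => /=;
  rewrite ?scaler0 ?addr0 // /GRing.scale /= mulr1 addrK.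
Qed.

(** Stands in for a strong maximum principle. By monotonicity [u] vanishes at all earlier times, so
    the equation there gives [f = 0]; then [comparison] with [mu = 0] gives [u <= 0] at all
    times. *)
Lemma solution_vanish t : 0 < t -> (forall x, Omega x -> u (x, t) = 0) ->
  forall z, closure D z -> u z = 0.
Proof.
move=> t0 ut0.
have u0 z : D z -> z.2 < t -> u z = 0.
  move=> Dz zt; have clz := subset_closure Dz.
  apply/eqP; rewrite eq_le solution_ge0// andbT.
  have tz : 0 <= t - z.2 by rewrite subr_ge0 ltW.
  have := solution_time_shift tz clz.
  suff -> : z + (0, t - z.2) = (z.1, t) by rewrite ut0//; exact: Dz.1.
  by case: z {Dz zt clz tz} => x y; congr (_, _); rewrite /= ?addr0// addrC subrK.
have near0 z : D z -> z.2 < t -> \forall w \near z, D w /\ w.2 < t.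
  move=> Dz zt; have DN := @near_D D z Dz (fun q Dq => Dq).
  have c2 : p.2 @[p --> z] --> z.2 by exact: cvg_snd.
  by apply: filterS2 DN (@cvgr_lt _ _ _ (nbhs_filter z) snd z.2 c2 _ zt).
have D0 v z : D z -> z.2 < t -> 'D_v u z = 0.
  move=> Dz zt; rewrite (@near_eq_derive _ _ _ u (cst 0)) ?derive_cst//.
  by apply: filterS (near0 _ Dz zt) => w [Dw wt]; rewrite u0.
have DD0 v z : D z -> z.2 < t -> 'D_v ('D_v u) z = 0.
  move=> Dz zt; rewrite (@near_eq_derive _ _ _ ('D_v u) (cst 0)) ?derive_cst//.
  by apply: filterS (near0 _ Dz zt) => w [Dw wt]; rewrite D0.
have f0 x : Omega x -> f x = 0.
  move=> Ox; have Dx : D (x, t / 2) by split => //=; rewrite in_itv /= andbT divr_gt0.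
  have xt : (x, t / 2).2 < t by rewrite /= ltr_pdivrMr// mulr_natr mulr2n ltrDl.
  have := heat Dx; rewrite D0// /laplacian big1 => [|i _]; last exact: DD0.
  by rewrite sub0r => /esym/eqP; rewrite oppr_eq0 => /eqP.
move=> z clz; apply/eqP; rewrite eq_le solution_ge0// andbT.
suff : 1 * u z <= 0 * u (1 *: z + 0) by rewrite mul1r mul0r.
have id1 w : (1 : R) *: w + 0 = w :> 'rV[R]_n * R by rewrite scale1r addr0.
apply: comparison => //.
- by move=> w; rewrite id1.
- by move=> w; rewrite id1.
- by move=> w clw; rewrite mul0r mul1r; exact: posD.
- by move=> w _; rewrite !mul0r.
- by move=> w [Ow _]; rewrite mul1r !mul0r f0.
Qed.

(** * Joint concavity of the root of the solution *)

Variable r : R.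
Hypothesis r0 : 0 <= r.
(* For a [q]-concave source [r = 1 / q], and [r = 0] for a constant one. The case [A = 0] contains
   [l `^ r * f y <= f ((1 - l) *: x + l *: y)]. *)
Hypothesis force_concave : forall x y l A B, Omega x -> Omega y -> 0 < l < 1 ->
  0 <= A -> 0 <= B -> (1 - l) * A + l * B = 1 ->
  (1 - l) * A `^ (1 - r) * f x + l * B `^ (1 - r) * f y <= f ((1 - l) *: x + l *: y).

(** [comparison] for the dilation with centre [z0]. The dilated function v satisfies v_t - Lap v =
    (l - l^2) u_t + l^2 f at the image point, at least l^(2 + r) f at the original point. An
    interior centre makes the dilation map the open cylinder into itself. *)
Let star_interior z0 z l : D z0 -> closure D z -> 0 < l < 1 ->
  l `^ (2 + r) * u z <= u (l *: z + (1 - l) *: z0).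
Proof.
move=> Dz0 clz l01; have /andP[l0 l1] := l01.
have l01' : 0 <= l <= 1 by rewrite !ltW.
have lE : l `^ (2 + r) = l ^+ 2 * l `^ r by rewrite powRD ?(gt_eqF l0) ?implybT// powR_mulrn// ltW.
suff : l `^ (2 + r) * u z <= 1 * u (l *: z + (1 - l) *: z0) by rewrite mul1r.
apply: comparison => //.
- by move=> w clw; rewrite addrC; apply: closure_cylinder_comb => //; exact: subset_closure.
- by move=> w Dw; rewrite addrC; exact: cylinder_comb.
- move=> w clw; rewrite !mul1r => uw; apply: posD => //.
  have : 0 < l `^ (2 + r) * u w.
    apply: le_lt_trans uw; apply: solution_ge0.
    by rewrite addrC; apply: closure_cylinder_comb => //; exact: subset_closure.
  by rewrite pmulr_rgt0// powR_gt0.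
- move=> w Dw; rewrite !mul1r; apply: ler_wpM2r.
    by apply: solution_dt_ge0; rewrite addrC; exact: cylinder_comb.
  by rewrite expr2 ler_piMr// ltW.
- move=> w [Ow _]; rewrite !mul1r lE -mulrA; apply: ler_wpM2l; first exact: sqr_ge0.

  (* The weights 0 and 1/l have mean 1. The term of [z0] is only bounded below by 0, since the power
     of 0 in it equals 1 when r = 1. *)
  have := @force_concave z0.1 w.1 l 0 l^-1 Dz0.1 Ow l01 (lexx _).
  rewrite invr_ge0 (ltW l0) mulr0 add0r mulfV ?gt_eqF// => /(_ isT erefl).
  rewrite [_ *: _ + _]addrC => /(le_trans _); apply.
  have -> : l * l^-1 `^ (1 - r) = l `^ r.
    rewrite -powR_inv1 ?ltW// -powRrM mulrBr mulr1 mulN1r opprK powRD ?(gt_eqF l0) ?implybT//.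
    by rewrite powR_inv1 ?ltW// mulrA mulfV ?gt_eqF// mul1r.
  rewrite lerDr; apply: mulr_ge0; last exact: hf Dz0.1.
  by rewrite mulr_ge0 ?powR_ge0// subr_ge0 ltW.
Qed.

(* Handles boundary points in [root_concave]: when [u z0 = 0], the concavity inequality between [z0]
   and [z] for [u^(1/(2 + r))] is exactly this one, so no boundary point lemma is needed. *)
Lemma solution_star z0 z l : closure D z0 -> closure D z -> 0 < l < 1 ->
  l `^ (2 + r) * u z <= u (l *: z + (1 - l) *: z0).
Proof.
move=> cl0 clz l01; rewrite leNgt; apply/negP => lt.
have /andP[l0 l1] := l01.
(* By continuity, centres violating the inequality form a relatively open subset of the closure; a
   nonempty one would meet the cylinder itself. *)
have cg : {within closure D, continuous (u \o (fun p => l *: z + (1 - l) *: p))}.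
  apply: within_continuous_map hu_closure.
    by move=> p; apply: cvgD; [exact: cvg_cst|apply: cvgZl_tmp; exact: cvg_id].
  by move=> p clp; rewrite addrC; apply: closure_cylinder_comb; rewrite // !ltW.
move/subspace_continuousP : cg => /(_ _ cl0) /cvgr_lt /(_ _ lt).
rewrite near_withinE => /cl0[p [Dp /(_ (subset_closure Dp)) /=]].
by rewrite ltNge star_interior.
Qed.

Let s := 2 + r.
Let w z := u z `^ s^-1.

Let s_gt0 : 0 < s. Proof. by rewrite ltr_wpDr. Qed.

Let near_pos z : D z -> 0 < u z -> \forall q \near z, D q /\ 0 < u q.
Proof.
move=> Dz uz; have [/subspace_continuousP cu _ _ _] := hu.
have := @cvgr_gt _ _ (within D (nbhs z)) (within_filter _ _) u (u z) (cu _ Dz) _ uz; rewrite near_withinE.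
move=> /(_ (nbhs_filter z)) H; have DN := @near_D D z Dz (fun q Dq => Dq).
by apply: filterS2 DN H => q Dq /(_ Dq).
Qed.

Let w_space i z : D z -> 0 < u z -> \forall q \near z, derivable w q (space_dir i).
Proof.
move=> Dz uz; apply: filterS (near_pos Dz uz) => q [Dq uq].
by have [] := is_derive_powR s^-1 (@u_space i _ Dq) uq.
Qed.

Let w_space2 i z : D z -> 0 < u z ->
  is_derive z (space_dir i) ('D_(space_dir i) w)
   (s^-1 * (u z `^ (s^-1 - 1) * 'D_(space_dir i) ('D_(space_dir i) u) z +
     (s^-1 - 1) * u z `^ (s^-1 - 1 - 1) * ('D_(space_dir i) u z) ^+ 2)).
Proof.
move=> Dz uz; apply: is_derive2_powR; last exact: u_space2.
by apply: filterS (near_pos Dz uz) => q [Dq uq]; split => //; exact: u_space.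
Qed.

Let w_time z : D z -> 0 < u z ->
  is_derive z time_dir w (s^-1 * u z `^ (s^-1 - 1) * 'D_time_dir u z).
Proof. by move=> Dz uz; apply: is_derive_powR => //; exact: u_time. Qed.

(** Put u = w^s in the heat equation and divide by s w^(s - 1). *)
Let root_equation z : D z -> 0 < u z ->
  laplacian w z = 'D_time_dir w z - s^-1 * w z `^ (1 - s) * f z.1 -
    (s - 1) * (\sum_(i < n) 'D_(space_dir i) w z ^+ 2) / w z.
Proof.
move=> Dz uz; rewrite /laplacian.
under eq_bigr => i _ do have [_ ->] := @w_space2 i _ Dz uz.
have [_ ->] := w_time Dz uz.
under [in RHS]eq_bigr => i _ do
  have [_ ->] := is_derive_powR s^-1 (@u_space i _ Dz) uz.
have s0 : s != 0 by rewrite gt_eqF.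
have -> : w z `^ (1 - s) = u z `^ (s^-1 - 1).
  by rewrite /w -powRrM mulrBr mulr1 mulVf.
have -> : 'D_time_dir u z = laplacian u z + f z.1 by rewrite heat // subrK.
under [in RHS]eq_bigr => i _ do rewrite exprMn.
rewrite -!mulr_sumr big_split/= -!mulr_sumr -/(laplacian u z).
set S := \sum_(_ < _) _.
have E : u z `^ (s^-1 - 1 - 1) * u z `^ s^-1 = u z `^ (s^-1 - 1) ^+ 2.
  rewrite expr2 -!powRD ?(gt_eqF uz) ?implybT//; congr (_ `^ _); ring.
have w0 : u z `^ s^-1 != 0 by rewrite gt_eqF // powR_gt0.
rewrite exprMn -E /w; field.
by rewrite w0 s0.
Qed.

(** The s-th root of [solution_star]: the concavity inequality for [w] with the value at [z0]
    replaced by 0. *)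
Let star_root z0 z l : closure D z0 -> closure D z -> 0 < l < 1 ->
  l * w z <= w (l *: z + (1 - l) *: z0).
Proof.
move=> cl0 clz l01; have /andP[l0 l1] := l01.
have -> : l * w z = (l `^ s * u z) `^ s^-1.
  rewrite powRM ?powR_ge0 ?solution_ge0// -powRrM mulfV ?gt_eqF// powRr1//.
  exact: ltW.
rewrite ge0_ler_powR ?invr_ge0 ?(ltW s_gt0) ?nnegrE ?mulr_ge0 ?powR_ge0 ?solution_ge0//.
  by rewrite addrC; apply: closure_cylinder_comb; rewrite // !ltW.
exact: solution_star.
Qed.

Let w_ge0 z : 0 <= w z. Proof. exact: powR_ge0. Qed.

Let w_gt0 z : closure D z -> 0 < w z -> 0 < u z.
Proof.
move=> cz wz; rewrite lt_neqAle solution_ge0// andbT; apply/eqP => u0.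
by move: wz; rewrite /w -u0 powR0 ?ltxx// invr_eq0 gt_eqF.
Qed.

(* At an interior maximum of [(1-l) w p0 + l w p1 - w ((1-l) p0 + l p1) - e t] the three gradients
   agree; moving [p0] and [p1] with the speeds [w p0 / W] and [w p1 / W], where [W] is the weighted
   mean of [w p0] and [w p1], makes the quadratic gradient terms of [root_equation] cancel. *)
Lemma root_concave z0 z1 l : D z0 -> D z1 -> 0 < l < 1 ->
  (1 - l) * w z0 + l * w z1 <= w ((1 - l) *: z0 + l *: z1).
Proof.
move=> Dz0 Dz1 l01; rewrite leNgt; apply/negP => neg.
have /andP[l0 l1] := l01; have k0 : 0 < 1 - l by rewrite subr_gt0.
have l01' : 0 <= l <= 1 by rewrite !ltW.
set T := Num.max z0.2 z1.2; pose K : set ('rV[R]_n * R) := closure Omega `*` `[0, T].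
have KD p : K p -> closure D p by exact: slab_closure.
have Kz0 : K z0.
  case: Dz0 => O0; rewrite /= in_itv /= andbT => t0; split; first exact: subset_closure.
  by rewrite /= in_itv /= ltW// le_max lexx.
have Kz1 : K z1.
  case: Dz1 => O1; rewrite /= in_itv /= andbT => t1; split; first exact: subset_closure.
  by rewrite /= in_itv /= ltW// le_max lexx orbT.
have T0 : 0 <= T by have [_] := Kz0; rewrite /= in_itv /= => /andP[+ _] => /le_trans; apply; rewrite le_max lexx.
set gap := (1 - l) * w z0 + l * w z1 - w ((1 - l) *: z0 + l *: z1).
have gap0 : 0 < gap by rewrite subr_gt0.
(* The penalty stays below half of the gap, so [Phi] keeps a positive maximum. *)
pose e := gap / (2 * (T + 1)).
have e0 : 0 < e by rewrite divr_gt0// mulr_gt0// ltr_wpDl.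
pose V := ('rV[R]_n * R)%type.
pose cb (p : V * V) : V := (1 - l) *: p.1 + l *: p.2.
pose Phi (p : V * V) := (1 - l) * w p.1 + l * w p.2 - w (cb p) - e * (cb p).2.
have cPhi : {within K `*` K, continuous Phi}.
  have cw : {within closure D, continuous w}.
    apply: within_continuous_powR hu_closure; first by rewrite invr_gt0.
    exact: solution_ge0.
  have cbc : continuous cb.
    by move=> p; apply: cvgD; apply: cvgZl_tmp; [exact: cvg_fst|exact: cvg_snd].
  have cw1 : {within K `*` K, continuous (w \o fst)}.
    by apply: within_continuous_map cw; [move=> p; exact: cvg_fst|move=> p [/KD]].
  have cw2 : {within K `*` K, continuous (w \o snd)}.
    by apply: within_continuous_map cw; [move=> p; exact: cvg_snd|move=> p [_ /KD]].
  have cwc : {within K `*` K, continuous (w \o cb)}.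
    apply: within_continuous_map cw => //.
    by move=> p [/KD p1 /KD p2]; exact: closure_cylinder_comb.
  have c2 : {within K `*` K, continuous (snd \o cb)}.
    by apply: continuous_subspaceT => p; apply: continuous_comp; [exact: cbc|exact: cvg_snd].
  move/subspace_continuousP in cw1; move/subspace_continuousP in cw2.
  move/subspace_continuousP in cwc; move/subspace_continuousP in c2.
  apply/subspace_continuousP => p Kp.
  apply: cvgB; [apply: cvgB; [apply: cvgD; apply: cvgM|]|apply: cvgM]; try exact: cvg_cst.
  - exact: cw1.
  - exact: cw2.
  - exact: cwc.
  - exact: c2.
have cK : compact (K `*` K) by apply: compact_setX; exact: compact_slab.
have [[q0 q1]] := compact_EVT_max (ex_intro (K `*` K) (z0, z1) (conj Kz0 Kz1)) cK cPhi.
rewrite inE => -[/= Kq0 Kq1] Fmax.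
have {}Fmax p0 p1 : K p0 -> K p1 -> Phi (p0, p1) <= Phi (q0, q1).
  by move=> Kp0 Kp1; apply: Fmax; rewrite inE.
pose ql := cb (q0, q1).
have cl0 := KD _ Kq0; have cl1 := KD _ Kq1.
have clq : closure D ql by exact: closure_cylinder_comb.
have comb_le (t0 t1 : R) : t0 <= T -> t1 <= T -> (1 - l) * t0 + l * t1 <= T.
  move=> h0 h1; apply: (@le_trans _ _ ((1 - l) * T + l * T)); first by rewrite lerD// ler_pM2l.
  by rewrite -mulrDl subrK mul1r.
have Phi0 : 0 < Phi (q0, q1).
  apply: lt_le_trans (Fmax _ _ Kz0 Kz1); rewrite /Phi /cb /= -/gap subr_gt0.
  have gE : gap = e * (2 * (T + 1)) by rewrite /e divfK// gt_eqF// mulr_gt0// ltr_wpDl.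
  rewrite gE ltr_pM2l//; apply: (@le_lt_trans _ _ T).
    by apply: comb_le; [have [_] := Kz0|have [_] := Kz1]; rewrite /= in_itv /= => /andP[].
  by rewrite mulrDr mulr1 -subr_gt0; nra.
have ql2 : 0 <= ql.2 by have /closure_cylinder[] := clq.
set W := (1 - l) * w q0 + l * w q1.
have mW : w ql < W.
  rewrite -subr_gt0; apply: lt_le_trans Phi0 _; rewrite /Phi -/W -/ql /=.
  by rewrite lerBlDr lerDl mulr_ge0// ltW.
(* If [w q1] were 0, then [W] would be [(1 - l) * w q0], which [star_root] with centre [q1] bounds
   by [w ql], against [mW]. *)
have w1pos : 0 < w q1.
  rewrite lt_neqAle w_ge0 andbT; apply/eqP => w10.
  have := star_root cl1 cl0 (l := 1 - l); rewrite subr_gt0 l1 gtrBl l0 subKr => /(_ isT).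
  by rewrite leNgt; move: mW; rewrite /W -w10 mulr0 addr0 => ->.
have w0pos : 0 < w q0.
  rewrite lt_neqAle w_ge0 andbT; apply/eqP => w00.
  have := star_root cl0 cl1 l01; rewrite [_ + _]addrC.
  by rewrite leNgt; move: mW; rewrite /W -w00 mulr0 add0r => ->.
have wlpos : 0 < w ql.
  have := star_root cl0 cl1 l01; rewrite [_ + _]addrC.
  by apply: lt_le_trans; rewrite mulr_gt0.
have u0 := w_gt0 cl0 w0pos; have u1 := w_gt0 cl1 w1pos; have ul := w_gt0 clq wlpos.
have D0 := posD cl0 u0; have D1 := posD cl1 u1; have Dl := posD clq ul.
have q0T : q0.2 <= T by have [_] := Kq0; rewrite /= in_itv /= => /andP[].
have q1T : q1.2 <= T by have [_] := Kq1; rewrite /= in_itv /= => /andP[].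
have cbE (v : V) (a b t : R) : cb (q0 + (a * t) *: v, q1 + (b * t) *: v) =
    ql + (((1 - l) * a + l * b) * t) *: v.
  by rewrite /ql /cb /= [in RHS]mulrDl -!mulrA !scalerDr !scalerA addrACA -scalerDl.
have space_max i a b : \forall t \near (0 : R),
    (1 - l) * w (q0 + (a * t) *: space_dir i) + l * w (q1 + (b * t) *: space_dir i) +
    -1 * w (ql + (((1 - l) * a + l * b) * t) *: space_dir i) <=
    (1 - l) * w q0 + l * w q1 + -1 * w ql.
  have H0 := @space_slab q0 i a T D0 q0T; have H1 := @space_slab q1 i b T D1 q1T.
  apply: filterS2 H0 H1 => t K0 K1.
  have := Fmax _ _ K0 K1; rewrite /Phi cbE -/ql /=.
  rewrite [X in e * (_ + X)](_ : _ = 0); last by rewrite /GRing.scale /= mulr0.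
  by rewrite addr0 lerD2r !mulN1r.
have time_max a b : 0 <= a -> 0 <= b -> \forall t \near 0^'-,
    (1 - l) * w (q0 + (a * t) *: time_dir) + l * w (q1 + (b * t) *: time_dir) +
    -1 * w (ql + (((1 - l) * a + l * b) * t) *: time_dir) <=
    (1 - l) * w q0 + l * w q1 + -1 * w ql + (e * ((1 - l) * a + l * b)) * t.
  move=> a0 b0.
  have H0 := @time_slab q0 a T a0 D0 q0T; have H1 := @time_slab q1 b T b0 D1 q1T.
  apply: filterS2 H0 H1 => t K0 K1.
  have := Fmax _ _ K0 K1; rewrite /Phi cbE -/ql /=.
  move: ((1 - l) * a + l * b) ((1 - l) *: q0.2 + l *: q1.2) => g y.
  have -> : (g * t)%:A = g * t by exact: mulr1.
  rewrite [e * (y + _)]mulrDr opprD addrA lerBlDr [leRHS]addrAC lerD2r !mulN1r.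
  by rewrite mulrA.
have W0 : 0 < W by apply: lt_trans mW.
(* Moving only one of the two points isolates its gradient. *)
have grad i : 'D_(space_dir i) w q0 = 'D_(space_dir i) w ql /\
    'D_(space_dir i) w q1 = 'D_(space_dir i) w ql.
  have [d0 _] := w_space2 i D0 u0; have [d1 _] := w_space2 i D1 u1.
  have [dl _] := w_space2 i Dl ul.
  have test a b := (line_test (w_space i D0 u0) (w_space i D1 u1) (w_space i Dl ul)
    d0 d1 dl (space_max i a b)).1.
  split.
    have := test 1 0; rewrite !(mulr0, mulr1, mul0r, addr0) mulN1r mulNr -mulrBr.
    by move/eqP; rewrite mulf_eq0 (gt_eqF k0)/= subr_eq0 => /eqP.
  have := test 0 1; rewrite !(mulr0, mulr1, mul0r, add0r) mulN1r mulNr -mulrBr.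
  by move/eqP; rewrite mulf_eq0 (gt_eqF l0)/= subr_eq0 => /eqP.
pose a := w q0 / W; pose b := w q1 / W.
have ab1 : (1 - l) * a + l * b = 1.
  by rewrite /a /b !mulrA -mulrDl -/W divff// gt_eqF.
have lap : (1 - l) * a ^+ 2 * laplacian w q0 + l * b ^+ 2 * laplacian w q1 <= laplacian w ql.
  rewrite /laplacian !mulr_sumr -big_split /=; apply: ler_sum => i _.
  have [d0 _] := w_space2 i D0 u0; have [d1 _] := w_space2 i D1 u1.
  have [dl _] := w_space2 i Dl ul.
  have [_] := line_test (w_space i D0 u0) (w_space i D1 u1) (w_space i Dl ul)
    d0 d1 dl (space_max i a b).
  by rewrite ab1 expr1n mulr1 mulN1r subr_le0.
(* In time the speeds are the squares, so that the first order test carries the weights of the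
   second order test in space. The combined point then moves with speed [kap] instead of 1, an
   excess that u_t >= 0 makes harmless. *)
pose A := a ^+ 2; pose B := b ^+ 2; pose kap := (1 - l) * A + l * B.
have a0 : 0 <= a by rewrite divr_ge0// ltW.
have b0 : 0 <= b by rewrite divr_ge0// ltW.
have kap1 : 1 <= kap.
  rewrite -subr_ge0; have -> : kap - 1 = (1 - l) * (a - 1) ^+ 2 + l * (b - 1) ^+ 2 +
      2 * ((1 - l) * a + l * b - 1) by rewrite /kap /A /B; ring.
  by rewrite ab1 subrr mulr0 addr0 addr_ge0// mulr_ge0 ?sqr_ge0// ltW.
have tim : e * kap <= (1 - l) * A * 'D_time_dir w q0 + l * B * 'D_time_dir w q1 -
    kap * 'D_time_dir w ql.
  have [d0 _] := w_time D0 u0; have [d1 _] := w_time D1 u1.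
  have [dl _] := w_time Dl ul.
  have := line_test_left d0 d1 dl (time_max A B (sqr_ge0 _) (sqr_ge0 _)).
  by rewrite -/kap mulN1r mulNr.
have dtl : 0 <= 'D_time_dir w ql.
  have [_ ->] := w_time Dl ul; apply: mulr_ge0; last exact: solution_dt_ge0.
  by rewrite mulr_ge0 ?powR_ge0 ?invr_ge0 ?ltW.

pose G := \sum_(i < n) 'D_(space_dir i) w ql ^+ 2.
have G0 : \sum_(i < n) 'D_(space_dir i) w q0 ^+ 2 = G.
  by apply: eq_bigr => i _; rewrite (grad i).1.
have G1 : \sum_(i < n) 'D_(space_dir i) w q1 ^+ 2 = G.
  by apply: eq_bigr => i _; rewrite (grad i).2.
have Gge0 : 0 <= G by apply: sumr_ge0 => i _; exact: sqr_ge0.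
have fl : 0 <= f ql.1 by exact: hf Dl.1.
have forcing := @force_concave q0.1 q1.1 l a b D0.1 D1.1 l01 a0 b0 ab1.
have eq0 := root_equation D0 u0; have eq1 := root_equation D1 u1.
rewrite G0 in eq0; rewrite G1 in eq1.
exact: (max_point_contradiction r0 l01 w0pos w1pos wlpos mW e0 Gge0 dtl fl
  eq0 eq1 (root_equation Dl ul) lap tim forcing).
Qed.

End heat_equation.

(** * Means of two numbers *)

(** Hoelder's inequality for two atoms of masses [k] and [l], from Young's inequality for the ratios
    x / X and y / Y. At [th = 1], which occurs for q = 1, the conjugate exponent is infinite and the
    case is separate. *)
Lemma weighted_hoelder {R : realType} (k l th x0 x1 y0 y1 : R) :
  0 < k -> 0 < l -> 0 < th <= 1 -> 0 <= x0 -> 0 <= x1 -> 0 <= y0 -> 0 <= y1 ->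
  k * (x0 `^ th * y0 `^ (1 - th)) + l * (x1 `^ th * y1 `^ (1 - th)) <=
  (k * x0 + l * x1) `^ th * (k * y0 + l * y1) `^ (1 - th).
Proof.
move=> k0 l0 /andP[th0]; rewrite le_eqVlt => /orP[/eqP ->|th1] x0p x1p y0p y1p.
  by rewrite subrr !powRr0 !mulr1 !powRr1// addr_ge0// mulr_ge0// ltW.
have th1' : 0 < 1 - th by rewrite subr_gt0.
have kl0 (a b : R) : 0 <= a -> 0 <= b -> k * a + l * b = 0 -> a = 0 /\ b = 0.
  move=> a0 b0 /eqP; rewrite paddr_eq0 ?mulr_ge0 ?(ltW k0) ?(ltW l0)//.
  by rewrite !mulf_eq0 (gt_eqF k0) (gt_eqF l0) => /andP[/eqP -> /eqP ->].
set X := k * x0 + l * x1; set Y := k * y0 + l * y1.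
have X0 : 0 <= X by rewrite addr_ge0// mulr_ge0// ltW.
have Y0 : 0 <= Y by rewrite addr_ge0// mulr_ge0// ltW.
have [XE|Xn0] := eqVneq X 0.
  have [-> ->] := kl0 _ _ x0p x1p XE.
  by rewrite powR0 ?(gt_eqF th0)// !mul0r !mulr0 addr0 mulr_ge0// powR_ge0.
have [YE|Yn0] := eqVneq Y 0.
  have [-> ->] := kl0 _ _ y0p y1p YE.
  by rewrite powR0 ?(gt_eqF th1')// !mulr0 addr0 mulr_ge0// powR_ge0.
have Xp : 0 < X by rewrite lt_neqAle eq_sym Xn0.
have Yp : 0 < Y by rewrite lt_neqAle eq_sym Yn0.
have young (x y : R) : 0 <= x -> 0 <= y ->
    x `^ th * y `^ (1 - th) <= (X `^ th * Y `^ (1 - th)) * (th * (x / X) + (1 - th) * (y / Y)).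
  move=> xp yp.
  have xX : 0 <= x / X by rewrite divr_ge0.
  have yY : 0 <= y / Y by rewrite divr_ge0.
  have := @conjugate_powR _ ((x / X) `^ th) ((y / Y) `^ (1 - th)) th^-1 (1 - th)^-1
    (powR_ge0 _ _) (powR_ge0 _ _).
  rewrite !invr_gt0 !invrK subrKC => /(_ th0 th1' erefl).
  rewrite -!powRrM !mulfV ?gt_eqF// !powRr1// ![_ * th]mulrC ![_ * (1 - th)]mulrC => yg.
  have {1}-> : x = X * (x / X) by rewrite mulrC divfK.
  have {1}-> : y = Y * (y / Y) by rewrite mulrC divfK.
  by rewrite (powRM _ X0 xX) (powRM _ Y0 yY) mulrACA ler_wpM2l// mulr_ge0// powR_ge0.
apply: le_trans (lerD (ler_wpM2l (ltW k0) (young _ _ x0p y0p))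
  (ler_wpM2l (ltW l0) (young _ _ x1p y1p))) _.
have -> : forall C : R, k * (C * (th * (x0 / X) + (1 - th) * (y0 / Y))) +
    l * (C * (th * (x1 / X) + (1 - th) * (y1 / Y))) = C * (th * (X / X) + (1 - th) * (Y / Y)).
  by move=> C; rewrite /X /Y; ring.
by rewrite !divff// !mulr1 subrKC mulr1.
Qed.

(** Hoelder with [th = 1/q], applied to the values of f^q and to [A], [B]; the second factor is 1 by
    the normalisation. *)
Lemma power_concave_forcing {R : realType} {E : lmodType R} (Omega : set E) (f : E -> R) (q : R) :
  1 <= q -> p_concave q%:E Omega f ->
  forall x y l A B, Omega x -> Omega y -> 0 < l < 1 ->
    0 <= A -> 0 <= B -> (1 - l) * A + l * B = 1 ->
    (1 - l) * A `^ (1 - q^-1) * f x + l * B `^ (1 - q^-1) * f y <= f ((1 - l) *: x + l *: y).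
Proof.
move=> q1 [f0 fc] x y l A B Ox Oy l01 A0 B0 AB; have /andP[l0 l1] := l01.
have q0 : 0 < q by exact: lt_le_trans q1.
apply: le_trans (fc x y l Ox Oy l01).
rewrite /power_mean (gt_eqF q0) lt_gtF//=.
have k0 : 0 < 1 - l by rewrite subr_gt0.
have th : 0 < q^-1 <= 1 by rewrite invr_gt0 q0 invf_le1.
have := weighted_hoelder k0 l0 th (powR_ge0 (f x) q) (powR_ge0 (f y) q) A0 B0.
have fK z : Omega z -> (f z `^ q) `^ q^-1 = f z.
  by move=> Oz; rewrite -powRrM mulfV ?gt_eqF// powRr1// f0.
rewrite AB powR1 mulr1 (fK _ Ox) (fK _ Oy).
by rewrite ![f _ * _ `^ _]mulrC !mulrA.
Qed.

(** * The one-dimensional Borell-Brascamp-Lieb inequality *)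

Section brunn_minkowski_line.
Context {R : realType}.
Notation RR := (measurableTypeR R).
Notation leb := (@lebesgue_measure R).
Implicit Types (L : set R) (l : R).

Lemma lebesgue_measure_cc (x y : R) : x <= y ->
  leb (`[x, y]%classic : set R) = (y - x)%:E.
Proof.
rewrite le_eqVlt => /orP[/eqP ->|xy].
  by rewrite lebesgue_measure_itv/= ltxx subrr.
by rewrite lebesgue_measure_itv/= lte_fin xy -EFinD.
Qed.

Lemma lebesgue_measure_diam L c : measurable (L : set RR) -> L !=set0 ->
  (forall x y, L x -> L y -> (y - x <= c)) -> (leb L <= c%:E)%E.
Proof.
move=> mL [x0 Lx0] Lc.
have lbL : has_inf L.
  by split; [exists x0|exists (x0 - c) => y /Lc/(_ Lx0); rewrite lerBlDr addrC -lerBlDr].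
have sub : L `<=` `[inf L, inf L + c]%classic.
  move=> y Ly; rewrite /= in_itv /=; apply/andP; split; first exact: (ge_inf lbL.2).
  rewrite -lerBlDr; apply: lb_le_inf lbL.1 _ => x Lx.
  by rewrite lerBlDr addrC -lerBlDr; exact: Lc.
have c0 : (0 <= c) by rewrite -(subrr x0) Lc.
have <- : leb (`[inf L, inf L + c]%classic : set R) = c%:E.
  by rewrite lebesgue_measure_cc ?lerDl// addrAC subrr add0r.
by apply: le_measure => //; rewrite inE//; exact: measurable_itv.
Qed.

Lemma lebesgue_measure_segment L x y : measurable (L : set RR) -> (x <= y) -> `[x, y]%classic `<=` L ->
  ((y - x)%:E <= leb L)%E.
Proof.
move=> mL xy sub.
rewrite -(lebesgue_measure_cc xy).
by apply: le_measure => //; rewrite inE//; exact: measurable_itv.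
Qed.

(** Being an interval, [Ll] contains the segment between any two combinations, so its measure
    dominates the weighted sum of the diameters of [L0] and [L1], and diameter dominates measure. *)
Lemma brunn_minkowski_line L0 L1 Ll l : measurable (L0 : set RR) -> measurable (L1 : set RR) ->
  measurable (Ll : set RR) -> L0 !=set0 -> L1 !=set0 -> is_interval Ll -> (0 < l < 1) ->
  (forall x y, L0 x -> L1 y -> Ll ((1 - l) * x + l * y)) ->
  ((1 - l)%:E * leb L0 + l%:E * leb L1 <= leb Ll)%E.
Proof.
move=> m0 m1 ml n0 n1 il /andP[l0 l1] comb.
have k0 : (0 < 1 - l) by rewrite subr_gt0.
have [->|] := eqVneq (leb Ll) +oo%E; first by rewrite leey.
rewrite -ltey => lfin.
have lE : leb Ll = (fine (leb Ll))%:E by rewrite fineK// ge0_fin_numE.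
set m := fine _ in lE.
have diam x x' y y' : L0 x -> L0 x' -> L1 y -> L1 y' -> (x <= x') -> (y <= y') ->
    ((1 - l) * (x' - x) + l * (y' - y) <= m).
  move=> Lx Lx' Ly Ly' xx yy.
  have sub : `[((1 - l) * x + l * y), ((1 - l) * x' + l * y')]%classic `<=` Ll.
    by move=> t; rewrite /= in_itv /=; exact: (il _ _ (comb _ _ Lx Ly) (comb _ _ Lx' Ly')).
  have le : ((1 - l) * x + l * y <= (1 - l) * x' + l * y') by rewrite lerD// ler_pM2l.
  have := lebesgue_measure_segment ml le sub; rewrite lE lee_fin; apply: le_trans.
  by rewrite !mulrBr opprD addrACA.
have d0 x x' y y' : L0 x -> L0 x' -> L1 y -> L1 y' -> (y <= y') ->
    (x' - x <= (m - l * (y' - y)) / (1 - l)).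
  move=> Lx Lx' Ly Ly' yy; rewrite ler_pdivlMr// mulrC lerBrDr.
  have [xx|xx] := leP x x'; first exact: diam.
  have := diam x x y y' Lx Lx Ly Ly' (lexx _) yy; apply: le_trans.
  by rewrite lerD2r ler_pM2l// subrr subr_le0 ltW.
have f0 : leb L0 \is a fin_num.
  case: n1 => y Ly; rewrite ge0_fin_numE//.
  apply: le_lt_trans (lebesgue_measure_diam m0 n0 _) (ltry _) => x x' Lx Lx'.
  exact: (d0 x x' y y).
(* The diameters are exhausted one at a time: for a fixed pair in [L1], [d0] bounds the measure of
   [L0], and the result bounds all distances in [L1]. *)
have d1 y y' : L1 y -> L1 y' -> (y' - y <= (m - (1 - l) * fine (leb L0)) / l).
  move=> Ly Ly'.
  have key : (y <= y') -> (y' - y <= (m - (1 - l) * fine (leb L0)) / l).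
    move=> yy.
    have : fine (leb L0) <= (m - l * (y' - y)) / (1 - l).
      by rewrite -lee_fin fineK//; apply: lebesgue_measure_diam => // x x' Lx Lx'; exact: d0.
    by rewrite !ler_pdivlMr// [_ * (1 - l)]mulrC [_ * l]mulrC !lerBrDr addrC.
  have [/key//|yy] := leP y y'.
  have [x Lx] := n0.
  apply: (@le_trans _ _ 0); first by rewrite subr_le0 ltW.
  rewrite divr_ge0 ?(ltW l0)// subr_ge0 [_ * fine _]mulrC -ler_pdivlMr//.
  rewrite -lee_fin fineK//; apply: lebesgue_measure_diam => // z z' Lz Lz'.
  have := d0 z z' y y Lz Lz' Ly Ly (lexx _); rewrite subrr mulr0 subr0; exact.
have := lebesgue_measure_diam m1 n1 d1; rewrite -(fineK f0) lE.
have f1 : leb L1 \is a fin_num.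
  by rewrite ge0_fin_numE//; apply: le_lt_trans (lebesgue_measure_diam m1 n1 d1) (ltry _).
rewrite -(fineK f1) -!EFinM -EFinD !lee_fin.
by rewrite ler_pdivlMr// lerBrDl mulrC [X in (_ + X <= _)]mulrC mulrC.
Qed.

End brunn_minkowski_line.

(* The cutoff lets the layer cake formula integrate over the whole line. *)
Definition superlevel_measure {R : realType} (g : R -> R) (t : R) : \bar R :=
  if (0 <= t)%R then lebesgue_measure [set x | t < g x] else 0%E.

Section layer_cake.
Context {R : realType}.
Notation RR := (measurableTypeR R).
Notation leb := (@lebesgue_measure R).
Variable g : R -> R.
Hypotheses (mg : measurable_fun (setT : set RR) (g : RR -> RR)) (g0 : forall x, 0 <= g x).

Let region : set (RR * RR) := [set p | 0 <= p.2 /\ p.2 < g p.1].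

Let measurable_region : measurable region.
Proof.
have -> : region = [set p : RR * RR | (0 <= p.2)%R] `&` [set p : RR * RR | (p.2 < g p.1)%R].
  by apply/seteqP; split => p [].
apply: measurableI.
  have m : measurable_fun setT (fun p : RR * RR => (0 <= p.2)%R) by exact: measurable_fun_ler.
  by have := m measurableT [set true] I; rewrite setTI.
have m : measurable_fun setT (fun p : RR * RR => (p.2 < g p.1)%R).
  by apply: measurable_fun_ltr => //; exact: measurableT_comp.
by have := m measurableT [set true] I; rewrite setTI.
Qed.

Let mindic : measurable_fun setT (fun p : RR * RR => (\1_region p)%:E : \bar R).
Proof. by apply/measurable_EFinP; exact: measurable_indic. Qed.

Lemma measurable_superlevel (t : R) : measurable ([set x | t < g x] : set RR).
Proof.
have m : measurable_fun setT (fun x : RR => (t < g x)%R) by exact: measurable_fun_ltr.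
by have := m measurableT [set true] I; rewrite setTI.
Qed.

Let superlevel_measureE :
  superlevel_measure g =
    fubini_G leb (fun p : RR * RR => (\1_region p)%:E).
Proof.
apply/funext => t; rewrite /superlevel_measure /fubini_G; case: ifPn => t0.
    transitivity (\int[leb]_x (\1_[set x | t < g x] x)%:E)%E.
      by rewrite integral_indic ?setIT//; exact: measurable_superlevel.
    by apply: eq_integral => x _; rewrite !indicE; congr ((nat_of_bool _)%:R%:E);
      (apply/idP/idP; rewrite !inE /region /= t0); [split|case].
  rewrite integral0_eq// => x _; rewrite indicE memNset// => -[/= t0' _].
  by rewrite t0' in t0.
Qed.

Lemma measurable_superlevel_measure :
  measurable_fun (setT : set RR) (superlevel_measure g).
Proof. by rewrite superlevel_measureE; exact: measurable_fun_fubini_tonelli_G. Qed.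

(** Tonelli on the region under the graph, whose sections are the segments from 0 to [g x] one way
    and the superlevel sets the other way. *)
Lemma layer_cake :
  (\int[leb]_x (g x)%:E = \int[leb]_t superlevel_measure g t)%E.
Proof.
transitivity (\int[leb]_x \int[leb]_t (\1_region (x, t))%:E)%E.
  apply: eq_integral => x _.
  transitivity (\int[leb]_t (\1_(`[0, g x[%classic : set R) t)%:E)%E; last first.
    by apply: eq_integral => t _; rewrite !indicE; congr ((nat_of_bool _)%:R%:E);
      apply/idP/idP; rewrite !inE /region /= in_itv /= => /andP.
  have <- : leb (`[0, g x[%classic : set R) = (g x)%:E.
    rewrite lebesgue_measure_itv/= lte_fin.
    have [gx|gx] := ltP 0 (g x); first by rewrite -EFinD subr0.
    by congr (_%:E); apply/eqP; rewrite eq_le gx g0.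
  by rewrite integral_indic ?setIT//; exact: measurable_itv.
rewrite (@fubini_tonelli _ _ _ _ _ leb leb (fun p => (\1_region p)%:E)) //.
by rewrite superlevel_measureE.
Qed.

End layer_cake.

(* [root_mean s l a b] is [power_mean (s^-1) a b l] for [s > 0]; roots are used because integrating
   out one variable just increases [s] by one. *)
Definition root_mean {R : realType} (s l a b : R) : R :=
  ((1 - l) * a `^ s^-1 + l * b `^ s^-1) `^ s.

Section root_mean_theory.
Context {R : realType}.
Implicit Types s l a b c : R.

Lemma root_mean_scale s l a b c : 0 < s -> 0 < l < 1 -> 0 <= c -> 0 <= a -> 0 <= b ->
  root_mean s l (c * a) (c * b) = c * root_mean s l a b.
Proof.
move=> s0 /andP[l0 l1] c0 a0 b0; rewrite /root_mean !powRM//.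
rewrite mulrCA [l * _]mulrCA -mulrDr powRM ?powR_ge0//; last first.
  by rewrite addr_ge0// mulr_ge0 ?powR_ge0// ?subr_ge0 ltW.
by rewrite -powRrM mulVf ?gt_eqF// powRr1.
Qed.

Lemma root_mean_const s l a : 0 < s -> 0 <= a -> root_mean s l a a = a.
Proof.
by move=> s0 a0; rewrite /root_mean -mulrDl subrK mul1r -powRrM mulVf ?gt_eqF// powRr1.
Qed.

Lemma root_mean_lt s l a b a' b' : 0 < s -> 0 < l < 1 -> 0 <= a -> 0 <= b -> a < a' -> b < b' ->
  root_mean s l a b < root_mean s l a' b'.
Proof.
move=> s0 /andP[l0 l1] a0 b0 aa bb; have k0 : 0 < 1 - l by rewrite subr_gt0.
have sV : 0 < s^-1 by rewrite invr_gt0.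
have lt (x y : R) : 0 <= x -> x < y -> x `^ s^-1 < y `^ s^-1.
  by move=> x0 xy; rewrite gt0_ltr_powR ?nnegrE// ltW// (le_lt_trans x0).
rewrite gt0_ltr_powR ?nnegrE ?addr_ge0 ?mulr_ge0 ?powR_ge0 ?(ltW k0) ?(ltW l0)//.
by rewrite ltrD// ltr_pM2l// lt.
Qed.

Lemma root_mean_gt0 s l a b : 0 < s -> 0 < l < 1 -> 0 < a -> 0 < b -> 0 < root_mean s l a b.
Proof.
by move=> s0 l01 a0 b0; rewrite -[ltLHS](root_mean_const l s0 (lexx 0)) root_mean_lt.
Qed.

(** Hoelder with [th = s / (s + 1)]. The arithmetic mean on the right is the root mean of index 1,
    and indices add; this is the gain of one per integration. *)
Lemma root_mean_hoelder s l a b x y : 0 < s -> 0 < l < 1 -> 0 <= a -> 0 <= b -> 0 <= x -> 0 <= y ->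
  root_mean (s + 1) l (a * x) (b * y) <= root_mean s l a b * ((1 - l) * x + l * y).
Proof.
move=> s0 /andP[l0 l1] a0 b0 x0 y0; have k0 : 0 < 1 - l by rewrite subr_gt0.
have s10 : 0 < s + 1 by rewrite addr_gt0.
pose th := s / (s + 1).
have thE : 1 - th = (s + 1)^-1 by rewrite /th; field; rewrite gt_eqF.
have th01 : 0 < th <= 1 by rewrite divr_gt0//= ler_pdivrMr// mul1r lerDl.
have := weighted_hoelder k0 l0 th01 (powR_ge0 a s^-1) (powR_ge0 b s^-1) x0 y0.
have sth : s^-1 * th = (s + 1)^-1 by rewrite /th mulrA mulVf ?gt_eqF// mul1r.
rewrite -!powRrM sth thE -!powRM// => H.
rewrite /root_mean; apply: le_trans (_ : (((1 - l) * a `^ s^-1 + l * b `^ s^-1) `^ th *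
  ((1 - l) * x + l * y) `^ (s + 1)^-1) `^ (s + 1) <= _).
  rewrite ge0_ler_powR ?nnegrE ?(ltW s10) ?mulr_ge0 ?powR_ge0//.
  by rewrite addr_ge0// mulr_ge0 ?powR_ge0// ltW.
rewrite powRM ?powR_ge0// -!powRrM mulVf ?gt_eqF// powRr1; last first.
  by rewrite addr_ge0// mulr_ge0// ltW.
by rewrite /th divfK// gt_eqF.
Qed.

End root_mean_theory.

Section prekopa_line.
Context {R : realType}.
Notation RR := (measurableTypeR R).
Notation leb := (@lebesgue_measure R).

(** Each function is divided by its supremum, or by the root mean [M] of the two suprema. At a
    common level the superlevel sets then satisfy the inclusion for Brunn-Minkowski; integration
    over levels gives (1 - l) J0 / M0 + l J1 / M1 <= Jl / M, and [root_mean_hoelder] removes the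
    suprema. *)
Lemma borell_brascamp_lieb_line (s l J0 J1 Jl C0 C1 : R) (g0 g1 gl : R -> R) :
  0 < s -> 0 < l < 1 ->
  measurable_fun (setT : set RR) (g0 : RR -> RR) -> measurable_fun (setT : set RR) (g1 : RR -> RR) ->
  measurable_fun (setT : set RR) (gl : RR -> RR) ->
  (forall x, 0 <= g0 x <= C0) -> (forall x, 0 <= g1 x <= C1) -> (forall x, 0 <= gl x) ->
  (forall x y t, 0 < gl x -> 0 < gl y -> 0 < t < 1 ->
     root_mean s t (gl x) (gl y) <= gl ((1 - t) * x + t * y)) ->
  (forall x y, 0 < g0 x -> 0 < g1 y ->
     root_mean s l (g0 x) (g1 y) <= gl ((1 - l) * x + l * y)) ->
  (\int[leb]_x (g0 x)%:E = J0%:E)%E -> (\int[leb]_x (g1 x)%:E = J1%:E)%E ->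
  (\int[leb]_x (gl x)%:E = Jl%:E)%E -> 0 < J0 -> 0 < J1 ->
  root_mean (s + 1) l J0 J1 <= Jl.
Proof.
move=> s0 l01 m0 m1 ml gC0 gC1 gl0 quasi comb I0 I1 Il J0p J1p.
have /andP[l0 l1] := l01; have k0 : 0 < 1 - l by rewrite subr_gt0.
have sup_facts (g : R -> R) C J : (forall x, 0 <= g x <= C) ->
    (\int[leb]_x (g x)%:E = J%:E)%E -> 0 < J ->
    exists M, [/\ 0 < M, forall x, g x <= M & forall c, c < M -> exists x, c < g x].
  move=> gC Ig Jp.
  have [x gx] : exists x, 0 < g x.
    apply: contrapT => /forallNP ng; move: Jp; rewrite -lte_fin -Ig integral0_eq ?ltxx// => x _.
    by congr (_%:E); apply/eqP; rewrite eq_le leNgt; have /andP[-> _] := gC x; rewrite andbT; apply/negP/ng.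
  have sg : has_sup (range g).
    by split; [exists (g x); exists x|exists C => _ [y _ <-]; have /andP[] := gC y].
  exists (sup (range g)); split.
  - by apply: lt_le_trans gx _; apply: (sup_upper_bound sg); exists x.
  - by move=> y; apply: (sup_upper_bound sg); exists y.
  - by move=> c cs; have [_ [y _ <-] cy] := sup_gt sg.1 cs; exists y.
have [M0 [M0p gM0 adh0]] := sup_facts _ _ _ gC0 I0 J0p.
have [M1 [M1p gM1 adh1]] := sup_facts _ _ _ gC1 I1 J1p.
pose M := root_mean s l M0 M1.
have Mp : 0 < M by exact: root_mean_gt0.
have scaled (g : R -> R) (c J : R) : 0 < c -> measurable_fun (setT : set RR) (g : RR -> RR) ->
    (forall x, 0 <= g x) -> (\int[leb]_x (g x)%:E = J%:E)%E ->
    (\int[leb]_t superlevel_measure (fun x => g x / c)%R t = (J / c)%:E)%E.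
  move=> c0 mg gge Ig; rewrite -layer_cake.
  - under eq_integral => x _ do rewrite mulrC EFinM.
    rewrite ge0_integralZl//; first by rewrite Ig -EFinM mulrC.
    + exact/measurable_EFinP.
    + by move=> x _; rewrite lee_fin.
    + by rewrite lee_fin invr_ge0 ltW.
  - exact: measurable_funM.
  - by move=> x; rewrite divr_ge0// ltW.
have g0ge x : 0 <= g0 x by have /andP[] := gC0 x.
have g1ge x : 0 <= g1 x by have /andP[] := gC1 x.
have L0 := scaled _ _ _ M0p m0 g0ge I0; have L1 := scaled _ _ _ M1p m1 g1ge I1.
have Ll := scaled _ _ _ Mp ml gl0 Il.
have mdiv (g : R -> R) c : measurable_fun (setT : set RR) (g : RR -> RR) ->
    measurable_fun (setT : set RR) ((fun x => g x / c) : RR -> RR).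
  by move=> mg; exact: measurable_funM.
have level_le t : ((1 - l)%:E * superlevel_measure (fun x => g0 x / M0)%R t +
    l%:E * superlevel_measure (fun x => g1 x / M1)%R t <=
    superlevel_measure (fun x => gl x / M)%R t)%E.
  rewrite /superlevel_measure; have [t0|t0] := leP 0 t; last by rewrite !mule0 adde0.
  (* From level 1 on both sets on the left are empty; below it both are nonempty, as
     [brunn_minkowski_line] demands. *)
  have [t1|t1] := ltP t 1; last first.
    have empty (g : R -> R) c : 0 < c -> (forall x, g x <= c) ->
        [set x | t < g x / c] = set0 :> set R.
      move=> c0 gc; apply/seteqP; split => // x /=.
      by rewrite ltNge (le_trans _ t1)// ler_pdivrMr// mul1r.
    by rewrite (empty _ _ M0p gM0) (empty _ _ M1p gM1) !measure0 !mule0 adde0.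
  apply: brunn_minkowski_line => //.
  - by apply: measurable_superlevel; exact: mdiv.
  - by apply: measurable_superlevel; exact: mdiv.
  - by apply: measurable_superlevel; exact: mdiv.
  - have [x gx] : exists x, t * M0 < g0 x by apply: adh0; rewrite gtr_pMl.
    by exists x; rewrite /= ltr_pdivlMr.
  - have [x gx] : exists x, t * M1 < g1 x by apply: adh1; rewrite gtr_pMl.
    by exists x; rewrite /= ltr_pdivlMr.
  (* Superlevel sets of [gl] are intervals because its s-th root is concave where positive. *)
  - move=> x y; rewrite /= !ltr_pdivlMr// => gx gy z /andP[xz zy].
    have tM : 0 <= t * M by rewrite mulr_ge0// ltW.
    rewrite /= ltr_pdivlMr//.
    have [<- //|xz'] := eqVneq x z; have [-> //|zy'] := eqVneq z y.
    have xz0 : x < z by rewrite lt_neqAle xz'.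
    have zy0 : z < y by rewrite lt_neqAle zy'.
    have xy : 0 < y - x by rewrite subr_gt0 (lt_trans xz0).
    pose c := (z - x) / (y - x).
    have c01 : 0 < c < 1.
      by rewrite /c ltr_pdivrMr// mul1r ltrD2r zy0 andbT divr_gt0// subr_gt0.
    have -> : z = (1 - c) * x + c * y by rewrite /c; field; rewrite gt_eqF.
    apply: lt_le_trans (quasi _ _ _ (le_lt_trans tM gx) (le_lt_trans tM gy) c01).
    by rewrite -[ltLHS](root_mean_const c s0 tM) root_mean_lt.
  - move=> x y; rewrite /= !ltr_pdivlMr// => gx gy.
    have tM0 : 0 <= t * M0 by rewrite mulr_ge0// ltW.
    have tM1 : 0 <= t * M1 by rewrite mulr_ge0// ltW.
    apply: lt_le_trans (comb _ _ (le_lt_trans tM0 gx) (le_lt_trans tM1 gy)).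
    by rewrite /M -(root_mean_scale s0 l01 t0 (ltW M0p) (ltW M1p)); exact: root_mean_lt.
have sm_ge0 (g : R -> R) t : (0 <= superlevel_measure g t)%E.
  by rewrite /superlevel_measure; case: ifP.
have ms (g : R -> R) c : measurable_fun (setT : set RR) (g : RR -> RR) ->
    measurable_fun (setT : set RR) (superlevel_measure (fun x => g x / c)).
  by move=> mg; apply: measurable_superlevel_measure; exact: mdiv.
have ms0 := ms _ M0 m0; have ms1 := ms _ M1 m1; have msl := ms _ M ml.
have key : (1 - l) * (J0 / M0) + l * (J1 / M1) <= Jl / M.
  rewrite -lee_fin EFinD [((1 - l) * _)%:E]EFinM [(l * _)%:E]EFinM -L0 -L1 -Ll.
  rewrite -!ge0_integralZl ?lee_fin ?(ltW k0) ?(ltW l0)//.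
  rewrite -ge0_integralD//; last 4 first.
  - by move=> t _; rewrite mule_ge0// lee_fin ltW.
  - exact: emeasurable_funM.
  - by move=> t _; rewrite mule_ge0// lee_fin ltW.
  - exact: emeasurable_funM.
  apply: ge0_le_integral => //.
  - by move=> t _; rewrite adde_ge0// mule_ge0// lee_fin ltW.
  - by apply: emeasurable_funD; exact: emeasurable_funM.
have := root_mean_hoelder s0 l01 (ltW M0p) (ltW M1p)
  (divr_ge0 (ltW J0p) (ltW M0p)) (divr_ge0 (ltW J1p) (ltW M1p)).
rewrite -/M [M0 * _]mulrC [M1 * _]mulrC !divfK ?gt_eqF// => /le_trans; apply.
by rewrite mulrC -ler_pdivlMr.
Qed.

End prekopa_line.

(** * Marginals *)

Section tuple_integrals.
Context {R : realType}.
Notation RR := (measurableTypeR R).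
Notation leb := (@lebesgue_measure R).

Lemma integral_lebesgue_measureS n (F : n.+1.-tuple RR -> \bar R) :
  measurable_fun setT F -> (forall x, (0 <= F x)%E) ->
  (\int[lebesgue_measure_n R n.+1]_x F x =
   \int[leb]_y \int[lebesgue_measure_n R n]_x F (cons_pair (y, x)))%E.
Proof.
move=> mF F0.
transitivity (\int[(leb \x lebesgue_measure_n R n)%E]_p F (cons_pair p))%E.
  exact: (ge0_integral_pushforward measurable_cons_pair _ measurableT mF).
rewrite (fubini_tonelli1 (fun p => F (cons_pair p)))//.
exact: (measurableT_comp mF measurable_cons_pair).
Qed.

Lemma measurable_integral_tail n (F : n.+1.-tuple RR -> \bar R) :
  measurable_fun setT F -> (forall x, (0 <= F x)%E) ->
  measurable_fun (setT : set RR)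
    (fun y => \int[lebesgue_measure_n R n]_x F (cons_pair (y, x)))%E.
Proof.
move=> mF F0.
apply: (measurable_fun_fubini_tonelli_F (fun p => F (cons_pair p))) => //.
exact: (measurableT_comp mF measurable_cons_pair).
Qed.

Definition box n (a : n.-tuple RR) (d : R) : set (n.-tuple RR) :=
  [set x | forall i, `|tnth x i - tnth a i| <= d].

Lemma measurable_box n (a : n.-tuple RR) d : measurable (box a d).
Proof.
have -> : box a d = \bigcap_(i in [set: 'I_n])
    (fun x : n.-tuple RR => tnth x i) @^-1` `[tnth a i - d, tnth a i + d]%classic.
  apply/seteqP; split => [x bx i _|x bx i].
    by rewrite /= in_itv /= -ler_distl.
  by have := bx i I; rewrite /= in_itv /= -ler_distl.
apply: fin_bigcap_measurable => // i _; rewrite -[X in measurable X]setTI.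
by apply: measurable_tnth => //; exact: measurable_itv.
Qed.

Lemma lebesgue_measure_box n (a : n.-tuple RR) d : 0 <= d ->
  lebesgue_measure_n R n (box a d) = ((2 * d) ^+ n)%:E.
Proof.
move=> d0; elim: n a => [a|n IH a].
  rewrite /= expr0 diracE mem_set// => -[].
  by [].
have E : @cons_pair _ RR n @^-1` box a d =
  (`[thead a - d, thead a + d]%classic : set RR) `*` box [tuple of behead a] d.
  apply/seteqP; split => -[y x].
    move=> /= bx; split => /=.
      have := bx ord0; rewrite /= in_itv /= -ler_distl.
      by rewrite /cons_pair /= (tnth_nth 0).
    move=> i; have := bx (lift ord0 i); rewrite !(tnth_nth 0) /= nth_behead.
    by [].
  move=> [/=]; rewrite in_itv /= -ler_distl => y0 bx i.
  case: (unliftP ord0 i) => [j ->|->]; last by rewrite (tnth_nth 0).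
  have := bx j; rewrite !(tnth_nth 0) /= nth_behead.
  by [].
transitivity ((leb \x lebesgue_measure_n R n)%E (@cons_pair _ RR n @^-1` box a d)); first by [].
rewrite E product_measure1E//; last exact: measurable_box.
rewrite IH [X in (X * _)%E]lebesgue_measure_cc; last by rewrite lerD2l ge0_cp.
by rewrite -EFinM exprS; congr (_ * _)%:E; ring.
Qed.

End tuple_integrals.

Section borell_brascamp_lieb.
Context {R : realType}.
Notation RR := (measurableTypeR R).
Notation leb := (@lebesgue_measure R).

Definition tuple_comb n (l : R) (x y : n.-tuple RR) : n.-tuple RR :=
  [tuple (1 - l) * tnth x i + l * tnth y i | i < n].

Lemma tuple_comb_cons n l (a b : R) (x y : n.-tuple RR) :
  tuple_comb l (cons_pair (a, x)) (cons_pair (b, y)) =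
  cons_pair ((1 - l) * a + l * b, tuple_comb l x y).
Proof.
apply: eq_from_tnth => i; rewrite tnth_mktuple.
case: (unliftP ord0 i) => [j ->|->]; last by rewrite !(tnth_nth 0).
by rewrite !tnthS tnth_mktuple.
Qed.

(** A bound on the values and on the support that passes to slices with the same constants, so that
    every partial integral is finite. *)
Definition supported_in_box n (F : n.-tuple RR -> R) (C M : R) :=
  forall x, F x <= C /\ (0 < F x -> forall i, `|tnth x i| <= M).

Lemma integral_supported_in_box n (F : n.-tuple RR -> R) C M :
  0 <= M -> measurable_fun setT F -> (forall x, 0 <= F x) -> supported_in_box F C M ->
  (\int[lebesgue_measure_n R n]_x (F x)%:E <= (C * (2 * M) ^+ n)%:E)%E.
Proof.
move=> M0 mF F0 FCM.
have C0 : 0 <= C by apply: le_trans (F0 [tuple 0 | i < n]) (FCM _).1.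
pose a : n.-tuple RR := [tuple 0 | i < n].
have -> : (C * (2 * M) ^+ n)%:E = (\int[lebesgue_measure_n R n]_x (C%:E * (\1_(box a M) x)%:E))%E.
  rewrite ge0_integralZl//; last first.
    by apply/measurable_EFinP; apply: measurable_indic; exact: measurable_box.
  rewrite integral_indic//; last exact: measurable_box.
  by rewrite setIT EFinM -(lebesgue_measure_box a M0).
apply: ge0_le_integral => //.
- by move=> x _; rewrite lee_fin.
- exact/measurable_EFinP.
- apply: emeasurable_funM => //; apply/measurable_EFinP; apply: measurable_indic.
  exact: measurable_box.
- move=> x _; rewrite -EFinM lee_fin indicE.
  have [Fx|Fx] := ltP 0 (F x); last first.
    by rewrite (le_trans Fx)// mulr_ge0.
  rewrite mem_set; first by rewrite mulr1 (FCM x).1.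
  by move=> i; rewrite tnth_mktuple subr0; exact: (FCM x).2.
Qed.

Lemma integral_supported_fin_num n (F : n.-tuple RR -> R) C M :
  0 <= M -> measurable_fun setT F -> (forall x, 0 <= F x) -> supported_in_box F C M ->
  (\int[lebesgue_measure_n R n]_x (F x)%:E)%E \is a fin_num.
Proof.
move=> M0 mF F0 FCM; rewrite ge0_fin_numE; last by apply: integral_ge0 => x _; rewrite lee_fin.
exact: le_lt_trans (integral_supported_in_box M0 mF F0 FCM) (ltry _).
Qed.

(** The parameter space is arbitrary because the induction enlarges it: the head coordinate joins
    the parameters, the induction hypothesis makes the integral over the tail jointly concave in
    both, and the inequality on the line integrates out the head. *)
Theorem borell_brascamp_lieb n (V : lmodType R) (F : V -> n.-tuple RR -> R) (s : R) :
  0 < s -> (forall v x, 0 <= F v x) -> (forall v, measurable_fun setT (F v)) ->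
  (forall v, exists C M, 0 <= M /\ supported_in_box (F v) C M) ->
  (forall v0 v1 x0 x1 l, 0 < l < 1 -> 0 < F v0 x0 -> 0 < F v1 x1 ->
    root_mean s l (F v0 x0) (F v1 x1) <= F ((1 - l) *: v0 + l *: v1) (tuple_comb l x0 x1)) ->
  let I v := fine (\int[lebesgue_measure_n R n]_x (F v x)%:E)%E in
  forall v0 v1 l, 0 < l < 1 -> 0 < I v0 -> 0 < I v1 ->
    root_mean (s + n%:R) l (I v0) (I v1) <= I ((1 - l) *: v0 + l *: v1).
Proof.
elim: n V F s => [|n IH] V F s s0 F0 mF suppF conc I v0 v1 l l01.
  have IE v : I v = F v [tuple].
    have mEF : measurable_fun setT (fun x => (F v x)%:E) by exact/measurable_EFinP.
    by rewrite /I /= integral_dirac// diracE mem_set// mul1e.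
  rewrite !IE addr0 => p0 p1; apply: le_trans (conc _ _ _ _ _ l01 p0 p1) _.
  by rewrite [tuple_comb _ _ _]tuple0.
pose F' (p : V * R) (x : n.-tuple RR) : R := F p.1 (cons_pair (p.2, x)).
pose G v y := fine (\int[lebesgue_measure_n R n]_x (F' (v, y) x)%:E)%E.
have mF' p : measurable_fun setT (F' p).
  apply: (measurableT_comp (mF p.1)).
  by apply: (measurableT_comp measurable_cons_pair); exact: pair1_measurable.
have suppF' p : exists C M, 0 <= M /\ supported_in_box (F' p) C M.
  have [C [M [M0 FCM]]] := suppF p.1; exists C, M; split => // x.
  have [FC FM] := FCM (cons_pair (p.2, x)); split => // /FM bx i.
  by have := bx (lift ord0 i); rewrite tnthS.
have finF' v y : (\int[lebesgue_measure_n R n]_x (F' (v, y) x)%:E = (G v y)%:E)%E.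
  have [C [M [M0 FCM]]] := suppF' (v, y).
  by rewrite /G fineK//; apply: integral_supported_fin_num FCM => // x; exact: F0.
have GE v : (\int[leb]_y (G v y)%:E = (I v)%:E)%E.
  have [C [M [M0 FCM]]] := suppF v.
  rewrite /I fineK; last exact: integral_supported_fin_num FCM.
  rewrite integral_lebesgue_measureS; [|exact/measurable_EFinP|by move=> x; rewrite lee_fin].
  by apply: eq_integral => y _; rewrite -finF'.
have G0 v y : 0 <= G v y by rewrite fine_ge0// integral_ge0// => x _; rewrite lee_fin F0.
have mG v : measurable_fun (setT : set RR) (G v : RR -> RR).
  apply: (measurableT_comp (fine_measurable _ )) => //.
  apply: (@measurable_integral_tail _ _ (fun x => (F v x)%:E)).
    exact/measurable_EFinP.
  by move=> x; rewrite lee_fin.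
have boundG v : exists C, forall y, 0 <= G v y <= C.
  have [C [M [M0 FCM]]] := suppF v; exists (C * (2 * M) ^+ n) => y.
  rewrite G0 -lee_fin -finF'; apply: integral_supported_in_box => // x; first exact: F0.
  have [FC FM] := FCM (cons_pair (y, x)); split => // /FM bx i.
  by have := bx (lift ord0 i); rewrite tnthS.
(* Serves twice: between the parameters [v0] and [v1], and with both parameters equal to their
   combination, where it gives concavity of the middle function. *)
have concG (w0 w1 : V) (y0 y1 t : R) : 0 < t < 1 -> 0 < G w0 y0 -> 0 < G w1 y1 ->
    root_mean (s + n%:R) t (G w0 y0) (G w1 y1) <=
    G ((1 - t) *: w0 + t *: w1) ((1 - t) * y0 + t * y1).
  move=> t01 p0 p1.
  apply: (IH (V * R)%type F' s s0 _ mF' suppF' _ (w0, y0) (w1, y1) t t01 p0 p1).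
    by move=> p x; exact: F0.
  move=> p q x0 x1 c c01 F0p F1p; rewrite /F' /=.
  by apply: le_trans (conc _ _ _ _ _ c01 F0p F1p) _; rewrite tuple_comb_cons.
have [C0 bC0] := boundG v0; have [C1 bC1] := boundG v1.
rewrite -natr1 addrA => I0 I1.
apply: (@borell_brascamp_lieb_line _ _ l _ _ _ C0 C1 (G v0) (G v1) (G ((1 - l) *: v0 + l *: v1))) => //.
- by rewrite ltr_wpDr.
- move=> x y t px py t01; have := concG _ _ _ _ _ t01 px py.
  by rewrite -scalerDl subrK scale1r.
- by move=> x y; exact: concG.
Qed.

End borell_brascamp_lieb.

(** * Concavity of the space integral *)

Section row_of_tuple_measurability.
Context {R : realType} {n : nat}.
Notation RR := (measurableTypeR R).

Lemma open_box (A : set 'rV[R]_n) (x : n.-tuple RR) : open A -> A (row_of_tuple x) ->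
  exists2 d : R, 0 < d & box x d `<=` @row_of_tuple R n @^-1` A.
Proof.
move=> oA Ax; have /nbhs_ballP[e /= e0 He] : nbhs (row_of_tuple x) A by exact: open_nbhs_nbhs.
exists (e / 2); first by rewrite divr_gt0.
move=> y bxy; apply: He; split => // i j.
rewrite /ball /= !mxE distrC (le_lt_trans (bxy j))//.
by rewrite ltr_pdivrMr// mulr_natr mulr2n ltrDl.
Qed.

(** Connects the topology of rows with the product sigma-algebra of tuples: an open set is the union
    of the countably many boxes with rational centre and radius 1 / (k + 1) that it contains. *)
Lemma measurable_row_preimage (A : set 'rV[R]_n) : open A ->
  measurable (@row_of_tuple R n @^-1` A).
Proof.
move=> oA.
pose B (c : n.-tuple rat * nat) : set (n.-tuple RR) :=
  box [tuple ratr (tnth c.1 i) | i < n] c.2.+1%:R^-1.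
pose P := [set c | B c `<=` @row_of_tuple R n @^-1` A].
have -> : @row_of_tuple R n @^-1` A = \bigcup_c (if `[< P c >] then B c else set0).
  apply/seteqP; split => [x Ax|x [c _]]; last by case: asboolP => // Pc /Pc.
  have [d d0 dA] := open_box oA Ax.
  (* Ensures 2 / (k + 1) < d: the centre is within 1 / (k + 1) of [x], and the box has that same
     radius. *)
  pose k := Num.truncn (2 / d).
  have kd : 2 * k.+1%:R^-1 < d.
    rewrite -ltr_pdivlMl// -[ltRHS]invrK ltf_pV2 ?posrE ?invr_gt0 ?mulr_gt0 ?invr_gt0//.
    by rewrite invfM invrK; exact: truncnS_gt.
  have k0 : (0 : R) < k.+1%:R^-1 by rewrite invr_gt0.
  have [c cx] : exists c : n.-tuple rat, forall i, `|tnth x i - ratr (tnth c i)| <= k.+1%:R^-1.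
    have cx i : {q : rat | `|tnth x i - ratr q| <= k.+1%:R^-1}.
      apply: cid; have xx : tnth x i < tnth x i + k.+1%:R^-1 by rewrite ltrDl.
      have [q] := rat_in_itvoo xx; rewrite in_itv /= => /andP[xq qx].
      by exists q; rewrite ler_distlC (ltW qx) andbT lerBlDr (le_trans (ltW xq))// lerDl ltW.
    exists [tuple sval (cx i) | i < n] => i; rewrite tnth_mktuple; exact: svalP (cx i).
  exists (c, k) => //; have Bx : B (c, k) x by move=> i; rewrite tnth_mktuple; exact: cx.
  rewrite asboolT// => y By; apply: dA => i.
  have := By i; have := Bx i; rewrite tnth_mktuple /= => h1 h2.
  rewrite -(subrK (ratr (tnth c i)) (tnth y i)) -addrA (le_trans (ler_normD _ _))//.
  by apply: le_trans (ltW kd); rewrite mulr_natl mulr2n lerD// distrC.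
apply: countable_bigcupT_measurable; first exact: countableP.
move=> c; case: ifP => _ //; exact: measurable_box.
Qed.

End row_of_tuple_measurability.

Lemma measurable_row_restrict {R : realType} {n : nat} (A : set 'rV[R]_n) (g : 'rV[R]_n -> R) :
  open A -> (forall x, A x -> {for x, continuous g}) ->
  measurable_fun setT ((g \o @row_of_tuple R n) \_ (@row_of_tuple R n @^-1` A)).
Proof.
move=> oA cg.
apply/(measurable_restrictT _ (measurable_row_preimage oA)).
move=> mD; apply: (measurability _ (RGenOInfty.measurableE R)) => //.
move=> _ [_ [a ->] <-].
have -> : (@row_of_tuple R n @^-1` A) `&` (g \o @row_of_tuple R n) @^-1` `]a, +oo[ =
    @row_of_tuple R n @^-1` (A `&` [set x | a < g x]).
  by apply/seteqP; split => x /=; rewrite in_itv /= andbT.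
apply: measurable_row_preimage; rewrite openE => x [Ax ax].
have nA : nbhs x A by exact: open_nbhs_nbhs.
by apply: filterS2 nA (cvgr_gt _ (cg _ Ax) _ ax).
Qed.

Section space_integral.
Context {R : realType} {n : nat} (Omega : set 'rV[R]_n) (f : 'rV[R]_n -> R)
  (u : 'rV[R]_n * R -> R).
Local Notation D := (cylinder Omega).
Hypotheses (hOmega : bounded_convex_domain Omega)
  (hf : forall x, Omega x -> 0 <= f x)
  (hu : C21 D u)
  (hu_closure : {within closure D, continuous u})
  (heq : forall (x : 'rV[R]_n) (t : R), D (x, t) ->
    'D_time_dir u (x, t) = laplacian u (x, t) + f x)
  (hbd : forall z, boundary D z -> u z = 0).

Let u_ge0 z : closure D z -> 0 <= u z.
Proof. exact: (solution_ge0 hOmega hf hu hu_closure heq hbd). Qed.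

Let D_intro x t : Omega x -> 0 < t -> D (x, t).
Proof. by move=> Ox t0; split => //=; rewrite in_itv /= andbT. Qed.

(** The solution extended by 0 to all times and all tuples, since [borell_brascamp_lieb] takes its
    parameter from a whole vector space; positivity of [F] then encodes membership in the
    cylinder. *)
Let F (t : R) (x : n.-tuple (measurableTypeR R)) : R :=
  if 0 < t then (((fun y => u (y, t)) \o @row_of_tuple R n) \_ (@row_of_tuple R n @^-1` Omega)) x
  else 0.

Let F_in t x : 0 < t -> Omega (row_of_tuple x) -> F t x = u (row_of_tuple x, t).
Proof. by move=> t0 Ox; rewrite /F t0 patchE mem_set. Qed.

Let F_pos t x : 0 < F t x -> [/\ 0 < t, Omega (row_of_tuple x) & F t x = u (row_of_tuple x, t)].
Proof.
rewrite /F; case: ifPn => [t0|_]; last by rewrite ltxx.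
rewrite patchE; case: ifPn => [|_]; last by rewrite ltxx.
by rewrite inE.
Qed.

Let F_ge0 t x : 0 <= F t x.
Proof.
rewrite /F; case: ifPn => // t0; rewrite patchE; case: ifPn => //; rewrite inE => Ox.
by apply: u_ge0; apply: subset_closure; exact: D_intro.
Qed.

Let u_slice_continuous t x : 0 < t -> Omega x -> {for x, continuous (fun y => u (y, t))}.
Proof.
move=> t0 Ox; have Dx := D_intro Ox t0; have [cu _ _ _] := hu.
have cux : {for (x, t), continuous u}.
  by move: cu; rewrite continuous_open_subspace; [apply; rewrite inE|exact: open_cylinder].
apply: (@continuous_comp _ _ _ (fun y => (y, t)) u); last exact: cux.
move=> S [[P Q] [/= nP nQ] PQ]; apply: filterS nP => y Py.
by apply: PQ; split => //; exact: nbhs_singleton nQ.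
Qed.

Let measurable_F t : measurable_fun setT (F t).
Proof.
rewrite /F; have [t0|t0] := ltP 0 t; last exact: measurable_cst.
apply: (@measurable_row_restrict _ _ Omega (fun y => u (y, t))).
  by have [] := hOmega.
by move=> x; exact: u_slice_continuous.
Qed.

Let F_supported t : exists C M, 0 <= M /\ supported_in_box (F t) C M.
Proof.
have [_ _ _ /ex_strict_bound_gt0[M M0 OM] _] := hOmega.
pose K := closure Omega `*` `[0%R, t]%classic.
have cu : {within K, continuous u}.
  apply: (within_continuous_map (g := id) (fun x => cvg_id (F := nbhs x)) _ hu_closure).
  by move=> z; exact: slab_closure.
have /ex_strict_bound_gt0[C C0 uC] : bounded_set (u @` K).
  by apply: compact_bounded; apply: continuous_compact => //; exact: compact_slab.
exists C, M; split; first exact: ltW.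
move=> x; split.
  have [/F_pos[t0 Ox ->]|Fx] := ltP 0 (F t x); last by rewrite (le_trans Fx)// ltW.
  apply: le_trans (ler_norm _) (ltW (uC _ _)); exists (row_of_tuple x, t) => //.
  by split; [exact: subset_closure|rewrite /= in_itv /= lexx ltW].
move=> /F_pos[t0 Ox _] i; have := ltW (OM _ Ox); apply: le_trans.
have -> : tnth x i = row_of_tuple x ord0 i by rewrite mxE.
rewrite [leRHS]/Num.norm /= mx_normrE; apply/bigmax_geP; right.
by exists (ord0, i).
Qed.

Let H (t : R) : R := integral_Rn Omega (fun x => u (x, t)).

Let HE t : 0 < t -> H t = fine (\int[lebesgue_measure_n R n]_x (F t x)%:E).
Proof.
move=> t0; rewrite /H /integral_Rn /Rintegral integral_mkcond; congr fine.
apply: eq_integral => x _; rewrite /F t0 !patchE; by case: ifP.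
Qed.

Let H_gt0 t : 0 < t -> (exists2 x, Omega x & 0 < u (x, t)) -> 0 < H t.
Proof.
move=> t0 [x Ox ux]; rewrite HE //.
(* On this open set [u] exceeds half its value at [x]; a box inside it bounds the integral from
   below. *)
pose A := Omega `&` [set y | u (x, t) / 2 < u (y, t)].
have [oO _ _ _ _] := hOmega.
have oA : open A.
  rewrite openE => y [Oy uy]; have nO : nbhs y Omega by exact: open_nbhs_nbhs.
  by apply: filterS2 nO (cvgr_gt _ (u_slice_continuous t0 Oy) _ uy).
pose a : n.-tuple (measurableTypeR R) := [tuple x ord0 i | i < n].
have ax : row_of_tuple a = x.
  by apply/rowP => i; rewrite !mxE tnth_mktuple.
have [|d d0 dA] := @open_box _ _ A a oA.
  by rewrite ax; split => //=; rewrite ltr_pdivrMr// mulr_natr mulr2n ltrDl.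
have [C [M [M0 FCM]]] := F_supported t.
have fin := integral_supported_fin_num M0 (measurable_F t) (F_ge0 t) FCM.
apply: (@lt_le_trans _ _ (u (x, t) / 2 * (2 * d) ^+ n)).
  by rewrite mulr_gt0 ?divr_gt0 ?exprn_gt0 ?mulr_gt0.
rewrite -lee_fin fineK// EFinM -(lebesgue_measure_box a (ltW d0)).
rewrite -[box a d]setIT -integral_indic//; last exact: measurable_box.
rewrite -ge0_integralZl//; last 2 first.
- by apply/measurable_EFinP; apply: measurable_indic; exact: measurable_box.
- by rewrite lee_fin divr_ge0// ltW.
apply: ge0_le_integral => //.
- by move=> y _; rewrite -EFinM lee_fin mulr_ge0// divr_ge0// ltW.
- apply: emeasurable_funM => //; apply/measurable_EFinP; apply: measurable_indic.
  exact: measurable_box.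
- exact/measurable_EFinP.
- move=> y _; rewrite -EFinM lee_fin indicE; case: (boolP (y \in box a d)) => yb /=.
    rewrite inE in yb; have [Oy uy] := dA _ yb.
    by rewrite mulr1 F_in// ltW.
  by rewrite mulr0.
Qed.

Lemma p_concave_space_integral (r : R) : 0 <= r ->
  (forall x y l A B, Omega x -> Omega y -> 0 < l < 1 ->
    0 <= A -> 0 <= B -> (1 - l) * A + l * B = 1 ->
    (1 - l) * A `^ (1 - r) * f x + l * B `^ (1 - r) * f y <= f ((1 - l) *: x + l *: y)) ->
  p_concave ((2 + r + n%:R)^-1)%:E (`]0, +oo[ : set R) H.
Proof.
move=> r0 forcing.
have s0 : 0 < 2 + r by rewrite ltr_wpDr.
have sn0 : 0 < 2 + r + n%:R by rewrite ltr_wpDr.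
have H0 t : 0 < t -> 0 <= H t.
  by move=> t0; rewrite HE// fine_ge0// integral_ge0// => x _; rewrite lee_fin.
split=> [t|t0 t1 l]; first by rewrite /= in_itv /= andbT; exact: H0.
rewrite /= !in_itv /= !andbT => t0p t1p l01; have /andP[l0 l1] := l01.
have k0 : 0 < 1 - l by rewrite subr_gt0.
have tlp : 0 < (1 - l) * t0 + l * t1 by rewrite addr_gt0// mulr_gt0.
rewrite invr_eq0 (gt_eqF sn0) invr_lt0 (lt_gtF sn0) /=.
(* [borell_brascamp_lieb] concerns positive integrals, whereas a mean of positive exponent with one
   zero entry can still be positive. A zero of [H] forces [u] to vanish everywhere. *)
have dichotomy t : 0 < t -> 0 < H t \/ forall z, closure D z -> u z = 0.
  move=> tp; have [[x Ox ux]|nex] := pselect (exists2 x, Omega x & 0 < u (x, t)).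
    by left; apply: H_gt0 => //; exists x.
  right; apply: (solution_vanish hOmega hf hu hu_closure heq hbd tp) => x Ox.
  apply/eqP; rewrite eq_le u_ge0 ?andbT; last by apply: subset_closure; exact: D_intro.
  by rewrite leNgt; apply/negP => ux; apply: nex; exists x.
have vanish : (forall z, closure D z -> u z = 0) -> forall t, 0 < t -> H t = 0.
  move=> u0 t tp; rewrite HE// integral0_eq// => x _.
  have [/F_pos[_ Ox ->]|Fx] := ltP 0 (F t x).
    by rewrite u0//; apply: subset_closure; exact: D_intro.
  by congr (_%:E); apply/eqP; rewrite eq_le Fx F_ge0.
have zero : (forall z, closure D z -> u z = 0) ->
    ((1 - l) * H t0 `^ (2 + r + n%:R)^-1 + l * H t1 `^ (2 + r + n%:R)^-1) `^ (2 + r + n%:R)^-1^-1 <=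
    H ((1 - l) * t0 + l * t1).
  move=> u0; rewrite !(vanish u0)// powR0 ?invr_eq0 ?gt_eqF// !mulr0 addr0 invrK.
  by rewrite powR0 ?gt_eqF.
have [H0p|/zero//] := dichotomy _ t0p; have [H1p|/zero//] := dichotomy _ t1p.
rewrite invrK; move: H0p H1p; rewrite !HE// => H0p H1p.
have := @borell_brascamp_lieb R n R^o F (2 + r) s0 F_ge0 measurable_F F_supported.
move=> /(_ _ t0 t1 l l01 H0p H1p); apply.
move=> v0 v1 x0 x1 c c01 /F_pos[v0p Ox0 ->] /F_pos[v1p Ox1 ->].
have /andP[c0 c1] := c01.
have rowE : row_of_tuple (tuple_comb c x0 x1) =
    (1 - c) *: row_of_tuple x0 + c *: row_of_tuple x1.
  by apply/rowP => i; rewrite !mxE tnth_mktuple.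
have Oc : Omega (row_of_tuple (tuple_comb c x0 x1)).
  by rewrite rowE; apply: (Omega_comb hOmega) => //; rewrite !ltW.
have vc : 0 < (1 - c) * v0 + c * v1 by rewrite addr_gt0// mulr_gt0// subr_gt0.
rewrite F_in//.
have D0 := D_intro Ox0 v0p; have D1 := D_intro Ox1 v1p.
have := root_concave hOmega hf hu hu_closure heq hbd r0 forcing D0 D1 c01.
have Dc := D_intro Oc vc.
have uc0 := u_ge0 (subset_closure Dc).
rewrite /root_mean rowE => rc.
have -> : u ((1 - c) *: row_of_tuple x0 + c *: row_of_tuple x1, (1 - c) *: (v0 : R^o) + c *: (v1 : R^o)) =
   (u ((1 - c) *: row_of_tuple x0 + c *: row_of_tuple x1, (1 - c) * v0 + c * v1) `^ (2 + r)^-1) `^ (2 + r).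
  by rewrite -powRrM mulVf ?gt_eqF// powRr1// -rowE.
rewrite ge0_ler_powR ?(ltW s0) ?nnegrE ?powR_ge0 ?addr_ge0 ?mulr_ge0 ?powR_ge0 ?(ltW c0) ?subr_ge0 ?(ltW c1)//.
Qed.

End space_integral.

Unset Implicit Arguments.
Set Strict Implicit.

Theorem corollary1p1 (R : realType) (n : nat) (Omega : set 'rV[R]_n)
    (f : 'rV[R]_n -> R) (u : 'rV[R]_n * R -> R)
    (hn : (1 <= n)%N)
    (hOmega : bounded_convex_domain Omega)
    (hf : forall x, Omega x -> 0 <= f x)
    (hu : C21 (cylinder Omega) u)
    (hu_closure : {within closure (cylinder Omega), continuous u})
    (heq : forall (x : 'rV[R]_n) (t : R), cylinder Omega (x, t) ->
      'D_time_dir u (x, t) = laplacian u (x, t) + f x)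
    (hbd : forall z, boundary (cylinder Omega) z -> u z = 0) :
  let H : R -> R := fun t => integral_Rn Omega (fun x => u (x, t)) in
  (forall q : R, 1 <= q -> p_concave q%:E Omega f ->
    p_concave (q / ((n%:R + 2) * q + 1))%:E (`]0, +oo[ : set R) H) /\
  ((exists2 c : R, 0 < c & forall x, Omega x -> f x = c) ->
    p_concave ((n%:R + 2)^-1)%:E (`]0, +oo[ : set R) H).
Proof.
move=> H; split=> [q q1 fq|[c c0 fc]].
  have q0 : 0 < q by exact: lt_le_trans q1.
  have -> : q / ((n%:R + 2) * q + 1) = (2 + q^-1 + n%:R)^-1.
    have nq : 0 < (n%:R + 2) * q + 1 by rewrite ltr_wpDl// mulr_ge0// ltW.
    have nq' : 0 < 2 + q^-1 + n%:R by rewrite ltr_wpDr// ltr_wpDr// invr_ge0 ltW.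
    apply: (mulIf (lt0r_neq0 nq')); rewrite mulVf ?gt_eqF//.
    by field; rewrite !gt_eqF.
  apply: (p_concave_space_integral hOmega hf hu hu_closure heq hbd).
    by rewrite invr_ge0 ltW.
  exact: power_concave_forcing q1 fq.
have -> : (n%:R + 2)^-1 = (2 + 0 + n%:R)^-1 :> R by rewrite addr0 addrC.
(* A constant source is the limit of infinite q, that is r = 0: [A] and [B] enter to the first power
   and their normalisation turns the condition into an equality. *)
apply: (p_concave_space_integral hOmega hf hu hu_closure heq hbd) => // x y l A B Ox Oy l01 A0 B0 AB.
have Ol : Omega ((1 - l) *: x + l *: y).
  by apply: (Omega_comb hOmega) => //; case/andP: l01 => l0 l1; rewrite !ltW.
by rewrite subr0 !powRr1// !fc// -mulrDl AB mul1r.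
Qed.
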